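(* There exists an algorithm that solves Edge Deletion to Cactus in time \(\mathcal{O}^{\star}(3^n)\).
   Context: Edge Deletion to Cactus: given a simple, undirected connected graph \(G=(V,E)\), find the size of a minimum sized set \(F\subseteq E\) such that \(H=(V,E\setminus F)\) is a connected cactus subgraph of \(G\). A cactus graph is a connected graph in which every edge belongs to at most one cycle. Here \(n=|V|\) and \(\mathcal{O}^{\star}(\cdot)\) hides factors polynomial in \(n\). *)

(* Defs.v *)
From mathcomp Require Import all_boot.

Set Implicit Arguments.
Unset Strict Implicit.
Unset Printing Implicit Defensive.

(** * Graphs *)

(* A graph with vertex type [T] is given by its set of edges, an edge being the
   set of its two endpoints. *)
Definition simple_graph (T : finType) (E : {set {set T}}) : Prop :=
  forall f, f \in E -> #|f| = 2.

Definition adj (T : finType) (E : {set {set T}}) : rel T :=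
  fun x y => [set x; y] \in E.

(* The graph without vertices is not considered connected. *)
Definition connected_graph (T : finType) (E : {set {set T}}) : Prop :=
  0 < #|T| /\ forall x y : T, connect (adj E) x y.

(* A cycle is a subgraph, identified with its set of edges [C]: rotating or
   reversing the vertex sequence [p] does not give another cycle. *)
Definition is_cycle (T : finType) (E C : {set {set T}}) : Prop :=
  exists p : seq T,
    [/\ 2 < size p, ucycle (adj E) p & C = [set [set x; next p x] | x in p]].

Definition cactus (T : finType) (E : {set {set T}}) : Prop :=
  connected_graph E /\
  forall f, f \in E -> forall C1 C2 : {set {set T}},
    is_cycle E C1 -> f \in C1 -> is_cycle E C2 -> f \in C2 -> C1 = C2.

Definition cactus_deletion (T : finType) (E F : {set {set T}}) : Prop :=
  F \subset E /\ cactus (E :\: F).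

Definition min_cactus_deletion (T : finType) (E : {set {set T}}) (k : nat) :
    Prop :=
  (exists2 F, cactus_deletion E F & #|F| = k) /\
  (forall F, cactus_deletion E F -> k <= #|F|).

(** * Random access machines with the logarithmic cost criterion *)

(* The machine has an unbounded array of cells holding natural numbers, and the
   arithmetic instructions and costs of the RAM of Aho, Hopcroft and Ullman;
   control flow is structured.  Subtraction is truncated and [x %/ 0 = 0]. *)
Definition memory := nat -> nat.

Definition update (m : memory) (a v : nat) : memory :=
  fun b => if b == a then v else m b.

Inductive binop := Add | Sub | Mul | Div.

Inductive expr :=
| Num of nat
| Read of expr
| Bin of binop & expr & expr.

Inductive prog :=
| Skip
| Write of expr & expr
| Seq of prog & prog
| If of expr & prog & prog
| While of expr & prog.

Definition eval_binop (o : binop) : nat -> nat -> nat :=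
  match o with Add => addn | Sub => subn | Mul => muln | Div => divn end.

Fixpoint eval (m : memory) (e : expr) : nat :=
  match e with
  | Num c => c
  | Read a => m (eval m a)
  | Bin o e1 e2 => eval_binop o (eval m e1) (eval m e2)
  end.

(* Length of the binary representation, with [bitlen 0 = 1]. *)
Definition bitlen (v : nat) : nat := (trunc_log 2 v).+1.

(* Every access to a cell is charged for its address and its contents, and every
   operation for its operands. *)
Fixpoint cost (m : memory) (e : expr) : nat :=
  match e with
  | Num c => bitlen c
  | Read a => cost m a + bitlen (eval m a) + bitlen (m (eval m a))
  | Bin _ e1 e2 =>
      cost m e1 + cost m e2 + bitlen (eval m e1) + bitlen (eval m e2)
  end.

Definition write_cost (m : memory) (a e : expr) : nat :=
  cost m a + cost m e + bitlen (eval m a) + bitlen (eval m e).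

Definition test_cost (m : memory) (e : expr) : nat :=
  cost m e + bitlen (eval m e).

(* [exec P m m' t]: started in memory [m], the program [P] halts in memory [m']
   after time [t]. *)
Inductive exec : prog -> memory -> memory -> nat -> Prop :=
| exec_skip m : exec Skip m m 1
| exec_write a e m :
    exec (Write a e) m (update m (eval m a) (eval m e)) (write_cost m a e)
| exec_seq P Q m m1 m2 t1 t2 :
    exec P m m1 t1 -> exec Q m1 m2 t2 -> exec (Seq P Q) m m2 (t1 + t2)
| exec_if_true e P Q m m1 t :
    eval m e != 0 -> exec P m m1 t -> exec (If e P Q) m m1 (test_cost m e + t)
| exec_if_false e P Q m m1 t :
    eval m e = 0 -> exec Q m m1 t -> exec (If e P Q) m m1 (test_cost m e + t)
| exec_while_true e P m m1 m2 t1 t2 :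
    eval m e != 0 -> exec P m m1 t1 -> exec (While e P) m1 m2 t2 ->
    exec (While e P) m m2 (test_cost m e + t1 + t2)
| exec_while_false e P m :
    eval m e = 0 -> exec (While e P) m m (test_cost m e).

Lemma exec_det P m m1 m2 t1 t2 :
  exec P m m1 t1 -> exec P m m2 t2 -> m1 = m2 /\ t1 = t2.
Proof.
move=> H; elim: H m2 t2 => {P m m1 t1} [m|a e m|P Q m m1 m1' t1 t1' _ IH1 _ IH2
  |e P Q m m1 t n0 _ IH|e P Q m m1 t e0 _ IH
  |e P m m1 m1' t1 t1' n0 _ IH1 _ IH2|e P m e0] m2 t2 H; inversion H; subst => //;
  repeat match goal with
  | h : is_true (eval ?m ?e != 0), h' : eval ?m ?e = 0 |- _ =>
      by rewrite h' in h
  | IH : (forall _ _, exec ?P ?m _ _ -> _), h : exec ?P ?m _ _ |- _ =>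
      have [? ?] := IH _ _ h; subst; clear h
  end; by [].
Qed.

(** * Algorithms on graphs *)

(* Cell [0] holds [n], the following [n * n] cells hold the adjacency matrix in
   row-major order, and all other cells hold [0]. *)
Definition graph_input (n : nat) (E : {set {set 'I_n}}) : memory :=
  nth 0 (n :: [seq nat_of_bool (adj E x y) | x <- enum 'I_n, y <- enum 'I_n]).

(* The answer is read in cell [0] of the final memory. *)
Definition solves_edge_deletion_to_cactus_in (P : prog) (T : nat -> nat) :
    Prop :=
  forall (n : nat) (E : {set {set 'I_n}}),
    simple_graph E -> connected_graph E ->
    exists m t, [/\ exec P (graph_input E) m t,
                    min_cactus_deletion E (m 0) & t <= T n].

(* [T = O*(f)]: [T] is at most [f] times a polynomial. *)
Definition bigO_star (T f : nat -> nat) : Prop :=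
  exists c d : nat, forall n, 0 < n -> T n <= c * n ^ d * f n.

(* Main.v *)
Require Import Defs.
From mathcomp Require Import all_boot.
From Stdlib Require Import Classical.
From mathcomp Require Import zify.

Set Implicit Arguments.
Unset Strict Implicit.
Unset Printing Implicit Defensive.

(* A connected cactus is grown from one vertex by successively attaching ears: a
   pendant edge, or a cycle meeting the current cactus [S] in a single vertex [v].
   Conversely, if [A] is a connected part of a cactus [H] that contains every cycle
   of [H] it shares an edge with, then any further edge of [H] at [A] is a bridge or
   lies on a cycle that meets [A] in one vertex only, so [H] can be grown from [A].
   A state of the dynamic program is a pair of disjoint sets [S] and [R] with [R]
   the vertices of an unfinished ear, its starting point [v] and its end [w]; the
   value is the largest number of edges used.  There are at most [3 ^ n * n ^ 2]
   states, each with at most [n] successors. *)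

(** * Edge sets of cycles *)

(** The edges chosen inside [S] can be forgotten: a new ear meets [S] only in [v], so every cycle
    using one of its new vertices is the ear itself, and legality of an ear depends on [S] and [v]
    alone. A pendant edge is treated as the degenerate closed sequence [[:: v; w]], whose edge set
    is a singleton. Both kinds of ear then share one argument, and the only trace of the difference
    is the correction [#|R| != 1] in the edge count. The base 3 reflects the three places of a
    vertex: outside, in [R], in [S]. The transition graph is acyclic, so one increasing scan over
    its arcs computes longest walks. Closing an ear turns all digits 1 into 2 at once. The machine
    has only arithmetic, so this is a lookup in a precomputed table, and the test for a pendant ear
    becomes a comparison of numbers. There are [3 ^ n * n ^ 3] arcs, each relaxed by boundedly many
    instructions on numbers of [O(n)] bits; under the logarithmic cost criterion this gives the
    factor [n ^ 4]. *)

Section CycleEdges.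

Variable T : finType.
Implicit Types (p q : seq T) (A C D E : {set {set T}}).

Definition cycle_edges p : {set {set T}} := [set [set x; next p x] | x in p].

Lemma adj_sym E : symmetric (adj E).
Proof. by move=> x y; rewrite /adj setUC. Qed.

Lemma connect_adj_sym E : connect_sym (adj E).
Proof. exact/sym_connect_sym/adj_sym. Qed.

Lemma adjS A E : A \subset E -> subrel (adj A) (adj E).
Proof. by move=> sAE x y; apply: (subsetP sAE). Qed.

Lemma connect_adjS A E : A \subset E -> subrel (connect (adj A)) (connect (adj E)).
Proof. by move=> sAE; apply: connect_sub => x y /(adjS sAE); apply: connect1. Qed.

Lemma set2_injr (x y z : T) : [set x; y] = [set x; z] -> y = z.
Proof.
move=> e; have: y \in [set x; z] by rewrite -e set22.
have: z \in [set x; y] by rewrite e set22.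
by rewrite !inE => /orP[] /eqP-> // /orP[] /eqP.
Qed.

Lemma mem_cycle_edges p f x : f \in cycle_edges p -> x \in f -> x \in p.
Proof.
case/imsetP=> y yp -> /set2P[] -> //; by rewrite mem_next.
Qed.

Lemma cycle_edges_at p f x : uniq p -> f \in cycle_edges p -> x \in f ->
  f = [set x; next p x] \/ f = [set x; prev p x].
Proof.
move=> Up /imsetP[y yp ->] /set2P[] ->; first by left.
by right; rewrite prev_next // setUC.
Qed.

Lemma cycle_edges_next p x : x \in p -> [set x; next p x] \in cycle_edges p.
Proof. by move=> xp; apply: imset_f. Qed.

Lemma cycle_edges_prev p x : uniq p -> x \in p ->
  [set x; prev p x] \in cycle_edges p.
Proof.
move=> Up xp; rewrite setUC -{2}(next_prev Up x).
by apply: cycle_edges_next; rewrite mem_prev.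
Qed.

Lemma next_neq p x : uniq p -> 1 < size p -> x \in p -> next p x != x.
Proof.
move=> Up sp /rot_to[i [|y q] def].
  by rewrite -(size_rot i) def in sp.
have: uniq (x :: y :: q) by rewrite -def rot_uniq.
rewrite -(next_rot i Up) def /= eqxx inE negb_or => /andP[/andP[+ _] _].
by rewrite eq_sym.
Qed.

Lemma next_neq_prev p x : uniq p -> 2 < size p -> x \in p ->
  next p x != prev p x.
Proof.
move=> Up sp xp; apply/eqP => e.
have: next p (next p x) = x by rewrite e next_prev.
move: xp => /rot_to[i [|y [|z q]] def].
- by rewrite -(size_rot i) def in sp.
- by rewrite -(size_rot i) def in sp.
have: uniq (x :: y :: z :: q) by rewrite -def rot_uniq.
rewrite -!(next_rot i Up) def /= eqxx.
rewrite eqxx; case: eqP => [->|_]; first by rewrite inE eqxx.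
by move=> + e1; rewrite e1 !inE eqxx orbT.
Qed.

Definition edges_at C x : {set {set T}} := [set f in C | x \in f].

Lemma edges_at_cycle p x : uniq p -> x \in p ->
  edges_at (cycle_edges p) x = [set [set x; next p x]; [set x; prev p x]].
Proof.
move=> Up xp; apply/setP=> f; rewrite inE in_set2; apply/andP/orP.
  by case=> fp xf; case: (cycle_edges_at Up fp xf) => ->; rewrite eqxx; auto.
by case=> /eqP->; rewrite set21 ?cycle_edges_next ?cycle_edges_prev.
Qed.

(** The Boolean covers degenerate sequences of at most two vertices, where successor and predecessor
    coincide. *)
Lemma card_edges_at_cycle p x : uniq p -> x \in p ->
  #|edges_at (cycle_edges p) x| = (next p x != prev p x).+1.
Proof.
move=> Up xp; rewrite edges_at_cycle // cards2; congr (nat_of_bool (~~ _)).+1.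
by apply/eqP/eqP => [/set2_injr|->].
Qed.

Lemma card_cycle_edges p : uniq p -> 2 < size p ->
  #|cycle_edges p| = size p.
Proof.
move=> Up sp; rewrite card_in_imset ?(card_uniqP Up) // => x y xp yp e.
apply/eqP/negPn/negP => xy.
have := next_neq_prev Up sp xp.
have: x \in [set y; next p y] by rewrite -e set21.
have: y \in [set x; next p x] by rewrite e set21.
rewrite !inE eq_sym (negPf xy) /= => /eqP-> /eqP ex.
by rewrite {2}ex prev_next // eqxx.
Qed.

Lemma cycle_cycle_edges p : uniq p -> cycle (adj (cycle_edges p)) p.
Proof. by move=> Up; apply: cycle_from_next => // x; apply: cycle_edges_next. Qed.

Lemma cycle_edges_sub E p : cycle (adj E) p -> cycle_edges p \subset E.
Proof. by move=> cp; apply/subsetP=> f /imsetP[x xp ->]; exact: next_cycle cp xp. Qed.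

Lemma cycle_edges_rot i p : uniq p -> cycle_edges (rot i p) = cycle_edges p.
Proof.
move=> Up; apply/setP=> f.
by apply/imsetP/imsetP=> -[x xp ->]; exists x => //;
  rewrite ?next_rot // ?mem_rot // -(mem_rot i).
Qed.

(** At a vertex of [p] the smaller set already has two edges and the larger at most two, so they
    agree there. Hence the vertices of [p] are closed under adjacency along [q], and connectedness
    of [q] makes them all of [q]. *)
Lemma cycle_edges_sub_eq p q : uniq p -> 2 < size p -> uniq q ->
  cycle_edges p \subset cycle_edges q -> cycle_edges p = cycle_edges q.
Proof.
move=> Up sp Uq spq.
have pq x : x \in p -> x \in q.
  move=> xp; apply: (@mem_cycle_edges q [set x; next p x]); last exact: set21.
  exact: (subsetP spq) (cycle_edges_next xp).
have at_eq x : x \in p ->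
    edges_at (cycle_edges p) x = edges_at (cycle_edges q) x.
  move=> xp; apply/eqP; rewrite eqEcard; apply/andP; split.
    apply/subsetP=> f; rewrite !inE => /andP[fp ->].
    by rewrite (subsetP spq).
  by rewrite !card_edges_at_cycle ?pq // (next_neq_prev Up sp xp) ltnS leq_b1.
case: p => // v p in Up sp spq pq at_eq *.
have qp x : x \in q -> x \in v :: p.
  have cl : closed (adj (cycle_edges q)) [in v :: p].
    apply: (intro_closed (@connect_adj_sym _)) => x' y axy xp.
    have: [set x'; y] \in edges_at (cycle_edges q) x' by rewrite inE set21 andbT.
    rewrite -at_eq // inE => /andP[h _].
    by apply: mem_cycle_edges h _; rewrite set22.
  move=> xq; have vq := pq v (mem_head _ _).
  have c := connect_cycle (cycle_cycle_edges Uq) vq xq.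
  by rewrite -[_ \in _ :: _](closed_connect cl c) inE eqxx.
apply/eqP; rewrite eqEsubset spq; apply/subsetP=> f fq.
have [x xq def_f] := imsetP fq.
have: f \in edges_at (cycle_edges q) x by rewrite inE fq def_f set21.
by rewrite -at_eq ?qp // inE => /andP[].
Qed.

(** For a single new vertex the way out and the way back are the same edge. *)
Lemma card_ear v p : uniq (v :: p) -> p != [::] ->
  #|cycle_edges (v :: p)| = size p + (size p != 1).
Proof.
case: p => [|a [|b p]] // Up _; last first.
  by rewrite card_cycle_edges //= addn1.
have -> : cycle_edges [:: v; a] = [set [set v; a]].
  apply/setP=> f; rewrite inE; apply/imsetP/eqP => [[x]|->].
    rewrite !inE => /orP[] /eqP-> ->; first by rewrite /= eqxx.
    rewrite /= eqxx; case: eqP => [->//|_]; exact: setUC.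
  by exists v; rewrite ?inE ?eqxx //= eqxx.
by rewrite cards1.
Qed.

End CycleEdges.

(** * Attaching an ear to a cactus *)

Section CactusOn.

Variable T : finType.
Implicit Types (p q : seq T) (S : {set T}) (A C D E : {set {set T}}).

(** The vertex type stays fixed while the cactus grows, so vertices outside [S] are isolated in [A]
    and connectedness has to be relative to [S]. *)
Definition cactus_on S A : Prop :=
  [/\ {in S &, forall x y, connect (adj A) x y},
      forall f, f \in A -> f \subset S &
      forall f, f \in A -> forall C1 C2 : {set {set T}},
        is_cycle A C1 -> f \in C1 -> is_cycle A C2 -> f \in C2 -> C1 = C2].

Lemma connect_ear S A v p : {in S &, forall x y, connect (adj A) x y} ->
  v \in S -> uniq (v :: p) ->
  {in S :|: [set x in p] &,
    forall x y, connect (adj (A :|: cycle_edges (v :: p))) x y}.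
Proof.
move=> conA vS Up.
suff con_v x : x \in S :|: [set x in p] ->
    connect (adj (A :|: cycle_edges (v :: p))) v x.
  move=> x y xS yS; apply: connect_trans (con_v y yS).
  by rewrite connect_adj_sym con_v.
rewrite !inE => /orP[xS|xp].
  by apply: connect_adjS (subsetUl _ _) _ _ (conA _ _ vS xS).
apply: connect_adjS (subsetUr _ _) _ _ _.
by apply: (connect_cycle (cycle_cycle_edges Up)); rewrite inE ?eqxx ?xp ?orbT.
Qed.

Lemma edges_ear S A v p : (forall f, f \in A -> f \subset S) -> v \in S ->
  forall f, f \in A :|: cycle_edges (v :: p) -> f \subset S :|: [set x in p].
Proof.
move=> sA vS f; rewrite inE => /orP[/sA fS|fC].
  by apply: subset_trans fS (subsetUl _ _).
apply/subsetP=> x /(mem_cycle_edges fC); rewrite !inE.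
by case/predU1P=> [->|->]; rewrite ?vS ?orbT.
Qed.

(* A cycle through a vertex [w] of the ear uses both ear edges at [w], hence
   runs through the whole ear. *)
Lemma cycle_through_ear S A v p q : (forall f, f \in A -> f \subset S) ->
  v \in S -> uniq (v :: p) -> {in p, forall x, x \notin S} ->
  uniq q -> 2 < size q -> cycle (adj (A :|: cycle_edges (v :: p))) q ->
  has [in q] p -> cycle_edges q = cycle_edges (v :: p).
Proof.
set C := cycle_edges (v :: p); set D := cycle_edges q.
move=> sA vS Uvp pS Uq sq cq /hasP[w wp wq].
have sDAC : D \subset A :|: C := cycle_edges_sub cq.
have atDC x : x \in p -> x \in q -> edges_at D x = edges_at C x.
  move=> xp xq; have xvp : x \in v :: p by rewrite inE xp orbT.
  apply/eqP; rewrite eqEcard; apply/andP; split; last first.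
    by rewrite !card_edges_at_cycle // (next_neq_prev Uq sq xq) ltnS leq_b1.
  apply/subsetP=> f; rewrite !inE => /andP[fD xf]; rewrite xf andbT.
  have:= subsetP sDAC f fD; rewrite inE => /orP[/sA/subsetP/(_ x xf)|//].
  by rewrite (negPf (pS x xp)).
have pn : p != [::] by case: (p) wp.
(* The cycle [q] has two distinct edges at [w], both ear edges, which excludes the pendant ear. *)
have sp : 2 < size (v :: p).
  have: 1 < #|C|.
    apply: leq_trans (subset_leq_card (_ : edges_at C w \subset C)).
      by rewrite -atDC // card_edges_at_cycle // (next_neq_prev Uq sq wq).
    by apply/subsetP=> f; rewrite inE => /andP[].
  by rewrite card_ear //=; case: (p) => [|a [|b r]].
have clq x y : x \in p -> x \in q -> adj C x y -> y \in q.
  move=> xp xq axy; have: [set x; y] \in edges_at C x by rewrite inE set21 andbT.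
  rewrite -atDC // inE => /andP[h _].
  by apply: mem_cycle_edges h _; rewrite set22.
(* Membership in [q] is propagated along ear edges inside [p] only, since [atDC] gives no control at
   [v]; the ear without [v] is still a connected path. *)
have pq x : x \in p -> x \in q.
  pose e := [rel x y | [&& x \in p, y \in p & adj C x y]].
  have e_sym : symmetric e.
    by move=> x1 y1 /=; rewrite [adj C y1 x1]adj_sym andbCA.
  have cl : closed e [in q].
    apply: (intro_closed (sym_connect_sym e_sym)) => x1 y1 /and3P[x1p y1p a1] x1q.
    exact: clq x1p x1q a1.
  have con y : y \in p -> connect e (head v p) y.
    have: path (adj C) v p.
      by have := cycle_cycle_edges Uvp; rewrite /= rcons_path => /andP[].
    case: (p) @e {e_sym cl} => // a r e /= /andP[_ pa].
    have pe : path e a r.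
      apply: (@sub_in_path _ [in a :: r] (adj C)) pa; last exact/allP.
      by move=> x1 y1 x1r y1r axy; apply/and3P.
    by move=> yar; apply: path_connect pe _ yar.
  move=> xp; have := closed_connect cl (con x xp).
  by have := closed_connect cl (con w wp); rewrite [w \in _]wq => -> <-.
symmetry; apply: cycle_edges_sub_eq => //; apply/subsetP=> f fC.
have fD x : x \in p -> x \in f -> f \in D.
  move=> xp xf; have: f \in edges_at C x by rewrite inE fC.
  by rewrite -atDC ?pq // inE => /andP[].
have [x xvp def_f] := imsetP fC.
have xf : x \in f by rewrite def_f set21.
move: xvp; rewrite inE => /predU1P[xv|/fD/(_ xf)//].
have nxf : next (v :: p) x \in f by rewrite def_f set22.
apply: fD nxf; have: next (v :: p) x \in v :: p by rewrite mem_next xv mem_head.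
rewrite inE => /predU1P[e|//].
have := @next_neq _ (v :: p) x Uvp (ltnW sp).
by rewrite {1}xv mem_head e xv eqxx => /(_ isT).
Qed.

Lemma cycle_edges_ear v p f : uniq (v :: p) -> p != [::] ->
  f \in cycle_edges (v :: p) -> exists2 x, x \in p & x \in f.
Proof.
move=> Uvp pn /imsetP[x]; rewrite inE => /predU1P[->|xp] ->; last first.
  by exists x; rewrite ?set21.
exists (next (v :: p) v); last exact: set22.
have: next (v :: p) v \in v :: p by rewrite mem_next mem_head.
rewrite inE => /predU1P[e|//]; have := @next_neq _ (v :: p) v Uvp.
by rewrite e eqxx mem_head /= ltnS lt0n size_eq0 pn => /(_ isT isT).
Qed.

(** A cycle of the enlarged graph that meets [p] is the whole ear, and one that avoids [p] is an old
    cycle inside [A]. Ear edges all meet [p] and old edges do not, so no edge lies on cycles of both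
    kinds. *)
Lemma cactus_on_ear S A v p : cactus_on S A -> v \in S -> p != [::] ->
  uniq (v :: p) -> {in p, forall x, x \notin S} ->
  cactus_on (S :|: [set x in p]) (A :|: cycle_edges (v :: p)).
Proof.
case=> conA sA uA vS pn Uvp pS; split.
- exact: connect_ear.
- exact: edges_ear.
set C := cycle_edges (v :: p).
have touch f := @cycle_edges_ear v p f Uvp pn.
have dichotomy D : is_cycle (A :|: C) D -> D = C \/ is_cycle A D /\ D \subset A.
  case=> q [sq /andP[cq Uq] def_D].
  have [pq|npq] := boolP (has [in q] p).
    by left; rewrite def_D; apply: (cycle_through_ear sA vS Uvp pS).
  right; have sDA : D \subset A.
    apply/subsetP=> f fD; have: f \in A :|: C.
      by apply: subsetP (cycle_edges_sub cq) _ _; rewrite -[cycle_edges q]def_D.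
    rewrite inE => /orP[//|/touch[x xp xf]].
    case/negP: npq; apply/hasP; exists x => //.
    by apply: mem_cycle_edges xf; rewrite -[cycle_edges q]def_D.
  split=> //; exists q; split=> //; rewrite /ucycle Uq andbT.
  by apply: sub_cycle (cycle_cycle_edges Uq); apply: adjS; rewrite -[cycle_edges q]def_D.
have AC f : f \in A -> f \in C -> False.
  move=> /sA/subsetP fS /touch[x xp /fS xS].
  by have := pS x xp; rewrite xS.
move=> f _ C1 C2 /dichotomy[->|[c1 s1]] f1 /dichotomy[->|[c2 s2]] f2 //.
- by case: (AC f); first exact: subsetP s2 _ f2.
- by case: (AC f); first exact: subsetP s1 _ f1.
by apply: (uA f) => //; apply: subsetP s1 _ f1.
Qed.

End CactusOn.

(** * The states of the dynamic program *)

Section States.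

Variables (T : finType) (E : {set {set T}}) (r : T).
Hypothesis simpleE : simple_graph E.
Implicit Types (p q : seq T) (S R : {set T}) (A C D H : {set {set T}}).

(* [S] carries a cactus, [R] is an open ear leading from [v] in [S] to [w], and
   [k] edges have been used. *)
Inductive dp_state : {set T} -> {set T} -> T -> T -> nat -> Prop :=
| dp_init : dp_state [set r] set0 r r 0
| dp_extend S R v w k u : dp_state S R v w k -> u \notin S -> u \notin R ->
    adj E w u -> dp_state S (u |: R) v u k.+1
| dp_close S R v w k u : dp_state S R v w k -> u \in S :|: R -> adj E w v ->
    dp_state (S :|: R) set0 u u (k + (#|R| != 1)).

Lemma adj_irrefl x : adj E x x = false.
Proof. by apply/negP => /simpleE; rewrite setUid cards1. Qed.

Lemma set_nil : [set x in [::] : seq T] = set0.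
Proof. by apply/setP=> x; rewrite !inE. Qed.

(** Edges of an open ear enter the witness [A] only when the ear is closed; until then [size p]
    accounts for them, and extending leaves the cactus untouched. *)
Lemma dp_state_sound S R v w k : dp_state S R v w k ->
  exists A p, [/\ cactus_on S A, A \subset E & v \in S] /\
    [/\ uniq (v :: p), path (adj E) v p & last v p = w] /\
    [/\ R = [set x in p], {in p, forall x, x \notin S} & k = #|A| + size p].
Proof.
elim=> {S R v w k} [|S R v w k u _ [A [p [[cA sA vS] [[Up pp lp] [dR pS dk]]]]] uS uR wu
  |S R v w k u _ [A [p [[cA sA vS] [[Up pp lp] [dR pS dk]]]]] uSR wv].
- exists set0, [::]; split; first split; rewrite ?sub0set ?set11 //; last first.
    by split; split; rewrite // ?cards0 ?set_nil.
  by split=> [x y|f|f]; rewrite ?inE // => /eqP-> /eqP->; apply: connect0.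
- exists A, (rcons p u); split=> //; split; first split.
  + rewrite -rcons_cons rcons_uniq Up andbT inE negb_or.
    move: uR; rewrite dR inE => ->; rewrite andbT.
    by apply: contraNneq uS => ->.
  + by rewrite rcons_path pp lp.
  + by rewrite last_rcons.
  split; last by rewrite size_rcons addnS dk.
  + by apply/setP=> x; rewrite dR !inE mem_rcons.
  by move=> x; rewrite mem_rcons inE => /predU1P[->//|/pS].
(* Closing an empty ear would need a loop at [v]. *)
have pn : p != [::].
  by apply: contraTneq wv => p0; rewrite -lp p0 /= adj_irrefl.
exists (A :|: cycle_edges (v :: p)), [::]; split.
  split; [by rewrite dR; apply: cactus_on_ear | | exact: uSR].
  rewrite subUset sA cycle_edges_sub //= rcons_path pp lp; exact: wv.
split=> //; split=> //.
have disj : [disjoint A & cycle_edges (v :: p)].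
  apply/pred0P=> f /=; apply/negP=> /andP[fA /(cycle_edges_ear Up pn)[x xp xf]].
  by case: cA => _ /(_ f fA)/subsetP/(_ x xf) + _; rewrite (negPf (pS x xp)).
move: disj; rewrite -leq_card_setU => /eqP->.
rewrite card_ear // dk addn0 addnA dR cardsE (card_uniqP _) //.
by case/andP: Up.
Qed.

Lemma dp_path S R v w k p : dp_state S R v w k -> path (adj E) w p -> uniq p ->
  {in p, forall x, x \notin S /\ x \notin R} ->
  dp_state S (R :|: [set x in p]) v (last w p) (k + size p).
Proof.
elim: p R w k => [|a p IH] R w k dp /=; first by rewrite set_nil setU0 addn0.
case/andP=> wa pa /andP[ap Up] out.
have [aS aR] := out a (mem_head _ _).
have := IH _ _ _ (dp_extend dp aS aR wa) pa Up; rewrite addSnnS.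
have -> : a |: R :|: [set x in p] = R :|: [set x in a :: p].
  by apply/setP=> x; rewrite !inE orbA; case: (x \in R); rewrite ?orbT ?orbF.
apply=> x xp; have [xS xR] : x \notin S /\ x \notin R.
  by apply: out; rewrite inE xp orbT.
by split=> //; rewrite !inE negb_or xR andbT; apply: contraNneq ap => <-.
Qed.

(** Packages a run of extensions and one closing. The free choice of [z] lets the next ear start
    anywhere in the enlarged cactus. *)
Lemma dp_ear S v k p z : dp_state S set0 v v k -> p != [::] -> uniq (v :: p) ->
  {in p, forall x, x \notin S} -> cycle (adj E) (v :: p) ->
  z \in S :|: [set x in p] ->
  dp_state (S :|: [set x in p]) set0 z z (k + #|cycle_edges (v :: p)|).
Proof.
move=> dp pn Uvp pS; rewrite /= rcons_path => /andP[pp lp] zS.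
have dp' : dp_state S [set x in p] v (last v p) (k + size p).
  rewrite -[X in dp_state S X](set0U [set x in p]); apply: dp_path => //.
    by case/andP: Uvp.
  by move=> x /pS; rewrite inE.
have := dp_close dp' zS lp.
by rewrite card_ear // addnA cardsE (card_uniqP _) //; case/andP: Uvp.
Qed.

Lemma exit_edge H S : (forall x y : T, connect (adj H) x y) ->
  S != set0 -> S != setT -> exists v w, [/\ v \in S, w \notin S & adj H v w].
Proof.
move=> conH /set0Pn[x xS] ST.
have [/exists_inP[v vS] /exists_inP[w wS vw]|no] :=
  boolP [exists v in S, [exists w in ~: S, adj H v w]].
  by exists v, w; split=> //; rewrite inE in wS.
case/eqP: ST; apply/setP=> y; rewrite inE.
rewrite -(closed_connect _ (conH x y)) //.
apply: (intro_closed (@connect_adj_sym _ _)) => v w vw vS.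
apply: contraNT no => wS; apply/exists_inP; exists v => //.
by apply/exists_inP; exists w; rewrite ?inE.
Qed.

(** Pendant edges alone grow a spanning tree. This ensures that the final table entry is not the
    default [0] of unreached states. *)
Lemma dp_spanning : (forall x y : T, connect (adj E) x y) ->
  exists k, dp_state setT set0 r r k.
Proof.
move=> conE.
suff grow m S k : #|~: S| = m -> r \in S ->
    (forall z, z \in S -> dp_state S set0 z z k) ->
    exists k, dp_state setT set0 r r k.
  apply: (grow _ [set r] 0 erefl (set11 r)) => z /set1P ->; exact: dp_init.
elim/ltn_ind: m S k => m IH S k dm rS dp.
have [eS|ST] := eqVneq S setT.
  by exists k; have := dp r rS; rewrite eS.
have [|v [w [vS wS vw]]] := exit_edge conE _ ST; first by apply/set0Pn; exists r.
have Uvw : uniq [:: v; w] by rewrite /= inE andbT; apply: contraNneq wS => <-.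
apply: (IH _ _ (S :|: [set x in [:: w]]) _ erefl); last first.
- move=> z zS; apply: dp_ear (dp _ vS) _ Uvw _ _ zS => //.
    by move=> x; rewrite inE => /eqP->.
  by rewrite /= vw adj_sym vw.
- by rewrite inE rS.
rewrite -dm; apply: proper_card; rewrite properC properUl //.
by apply/subsetPn; exists w; rewrite // !inE.
Qed.

End States.

(** * Every connected spanning cactus is reached by the dynamic program *)

Section Completeness.

Variables (T : finType) (E : {set {set T}}) (r : T).
Hypothesis simpleE : simple_graph E.
Implicit Types (p q : seq T) (S R : {set T}) (A C D H : {set {set T}}).

Definition cycle_closed H A : Prop :=
  forall D f g, is_cycle H D -> f \in D -> f \in A -> g \in D -> g \in A.

Lemma path_edges_inside S A x p : (forall f, f \in A -> f \subset S) ->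
  path (adj A) x p -> {in p, forall y, y \in S}.
Proof.
move=> sA; elim: p x => //= a p IH x /andP[xa pp] y; rewrite inE.
case/predU1P=> [->|]; last exact: IH pp y.
by apply: (subsetP (sA _ xa)); rewrite set22.
Qed.

(* Otherwise the walk closes up inside [S] to a cycle of [H] that contains an
   edge of [A] and the first edge of the walk. *)
Lemma no_return S A H v y p : A \subset H ->
  (forall f, f \in A -> f \subset S) -> {in S &, forall x y, connect (adj A) x y} ->
  cycle_closed H A -> v \in S -> y \in S -> y != v ->
  {in p, forall x, x \notin S} -> uniq p -> path (adj H) v (rcons p y) ->
  [set v; head y p] \in A.
Proof.
move=> sAH sA conA clA vS yS yv pS Up.
rewrite rcons_path => /andP[pp ly].
have /connectP[q0 pq0] := conA _ _ yS vS.
case/shortenP: pq0 => -[|b q] pq Uq _ lq; first by rewrite lq /= eqxx in yv.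
have qS := path_edges_inside sA pq.
have yb : [set y; b] \in A by case/andP: pq.
(* The cycle leaves [v] through [p], enters [S] at [y] and returns along a simple path of [A]; [v]
   is its last entry. *)
pose s := p ++ [:: y, b & q].
have ls : last v s = v by rewrite last_cat; exact: esym lq.
have Us : uniq s.
  rewrite cat_uniq Up Uq andbT; apply/hasPn => x; rewrite inE.
  case/predU1P=> [->|/qS xS]; apply/negP => /pS; first by rewrite yS.
  by rewrite xS.
have cs : cycle (adj H) s.
  rewrite (cycle_path v) ls cat_path pp /= ly.
  exact: sub_path (adjS sAH) _ _ pq.
have := cycle_next Us; rewrite (cycle_path v) ls => fs.
(* With at most two vertices, [p] and [q] are empty and [b = v]: the walk is the edge [yv], which
   the path in [A] already uses. *)
have [sp|sp] := leqP (size s) 2.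
  move: sp; rewrite size_cat /=; case: (p) => [|? ?]; last by rewrite !addnS.
  by move: lq; case: (q) => //= -> _; rewrite setUC.
apply: (clA (cycle_edges s) [set y; b]) => //.
- by exists s; split=> //; rewrite /ucycle cs.
- move: fs; rewrite cat_path /= => /and3P[_ _ /andP[/eqP nb _]].
  by rewrite -nb; apply: cycle_edges_next; rewrite mem_cat mem_head orbT.
have -> : head y p = next s v.
  move: fs; rewrite /s; case: (p) => [|a p'] /=.
    by case/and3P=> /eqP.
  by case/andP=> /eqP.
apply: cycle_edges_next; rewrite mem_cat lq; apply/orP; right; exact: mem_last.
Qed.

Lemma cycle_edges2 (v w : T) : v != w -> cycle_edges [:: v; w] = [set [set v; w]].
Proof.
move=> vw; apply/eqP; rewrite eq_sym eqEcard sub1set cards1.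
rewrite (card_ear _ _) /= ?inE ?vw // andbT.
by have := @cycle_edges_next _ [:: v; w] v (mem_head _ _); rewrite /= eqxx.
Qed.

(* The ear is the cycle through [vw] if there is one, and the single bridge [vw]
   otherwise. *)
Lemma exists_ear S A H v w : H \subset E ->
  (forall f, f \in H -> forall C1 C2 : {set {set T}},
     is_cycle H C1 -> f \in C1 -> is_cycle H C2 -> f \in C2 -> C1 = C2) ->
  A \subset H ->
  (forall f, f \in A -> f \subset S) -> {in S &, forall x y, connect (adj A) x y} ->
  cycle_closed H A -> v \in S -> adj H v w -> [set v; w] \notin A ->
  exists p, [/\ p != [::], uniq (v :: p) & {in p, forall x, x \notin S}] /\
    [/\ cycle (adj H) (v :: p), [disjoint A & cycle_edges (v :: p)] &
        cycle_closed H (cycle_edges (v :: p))].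
Proof.
move=> sHE uH sAH sA conA clA vS vw vwA.
have nvw : w != v.
  apply: contraTneq vw => ->; apply/negP=> /(subsetP sHE).
  by rewrite -/(adj E v v) adj_irrefl.
have wS : w \notin S.
  apply: contra vwA => wS; apply: (@no_return S A H v w [::]) => //=.
  by rewrite vw.
have [[C [cC vwC]]|nC] :=
  classic (exists C, is_cycle H C /\ [set v; w] \in C); last first.
  exists [:: w]; split; split=> //.
  - by rewrite /= inE eq_sym nvw.
  - by move=> x; rewrite inE => /eqP->.
  - by rewrite /= vw adj_sym vw.
  - rewrite cycle_edges2 1?eq_sym //; apply/pred0P=> f /=; apply/negP=> /andP[fA].
    by rewrite inE => /eqP ef; rewrite -ef fA in vwA.
  rewrite cycle_edges2 1?eq_sym // => D f g cD fD /set1P ef _.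
  by case: nC; exists D; rewrite -ef.
have [q [sq /andP[cq Uq] def_C]] := cC.
have vq : v \in q.
  apply: (@mem_cycle_edges _ q [set v; w]); last exact: set21.
  by rewrite -[cycle_edges q]def_C.
have [i p def_q] := rot_to vq.
have Up : uniq (v :: p) by rewrite -def_q rot_uniq.
have cp : cycle (adj H) (v :: p) by rewrite -def_q rot_cycle.
have eC : cycle_edges (v :: p) = C by rewrite -def_q cycle_edges_rot.
have pn : p != [::].
  by apply: contraTneq sq => p0; rewrite -(size_rot i) def_q p0.
have AC : [disjoint A & C].
  apply/pred0P=> f /=; apply/negP=> /andP[fA fC].
  by case/negP: vwA; apply: clA cC fC fA vwC.
exists p; rewrite eC; split; split=> //; last first.
  move=> D f g cD fD fC gD; rewrite (uH f _ C D cC fC cD fD) //.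
  by rewrite def_C in fC; apply: subsetP (cycle_edges_sub cq) _ fC.
suff nh : ~~ has [in S] p by move=> x xp; apply: contra nh => xS; apply/hasP; exists x.
(* After rotation [vw] may be the last edge of the cycle instead of the first, so the contradiction
   is drawn from the edge [v], [head v p] and disjointness of [A] from all of [C]. The walk is cut
   at its first return [x] to [S]. *)
apply/negP=> hS; have vp : [set v; head v p] \in C.
  rewrite -eC; have := @cycle_edges_next _ (v :: p) v (mem_head _ _).
  by case: (p) pn => //= a p' _; rewrite eqxx.
have [x [p1 [p2 [xS np1 def_p]]]] : exists x p1 p2,
    [/\ x \in S, ~~ has [in S] p1 & p = rcons p1 x ++ p2].
  by case: (split_find_nth v hS) => x p1 p2 xS np1; exists x, p1, p2.
have hd : head v (rcons p1 x ++ p2) = head x p1 by case: (p1).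
move: cp vp Up; rewrite def_p hd /= rcons_path cat_path => /andP[/andP[pp1 _] _] vp.
rewrite mem_cat mem_rcons inE cat_uniq rcons_uniq !negb_or.
case/andP=> [/andP[/andP[vx _] _] /andP[/andP[_ Up1] _]].
have := disjointFl AC vp; rewrite (@no_return S A H v x p1) // 1?eq_sym //.
by move=> z zp; apply: contra np1 => zS; apply/hasP; exists z.
Qed.

(** Induction on the edges of [H] not yet in [A]: an edge of [H] missing at [S] yields a new ear. If
    none is missing, [S] is closed under adjacency in [H], so connectedness gives [S = setT] and
    then [A = H]. *)
Lemma dp_state_complete H : H \subset E -> (forall x y : T, connect (adj H) x y) ->
  (forall f, f \in H -> forall C1 C2 : {set {set T}},
     is_cycle H C1 -> f \in C1 -> is_cycle H C2 -> f \in C2 -> C1 = C2) ->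
  dp_state E r setT set0 r r #|H|.
Proof.
move=> sHE conH uH.
suff grow m S A : #|H :\: A| = m -> r \in S -> A \subset H ->
    (forall f, f \in A -> f \subset S) ->
    {in S &, forall x y, connect (adj A) x y} -> cycle_closed H A ->
    (forall z, z \in S -> dp_state E r S set0 z z #|A|) ->
    dp_state E r setT set0 r r #|H|.
  apply: (grow _ [set r] set0 erefl (set11 r)); rewrite ?sub0set //.
  - by move=> f; rewrite inE.
  - by move=> x y /set1P-> /set1P->; apply: connect0.
  - by move=> D f g _ _; rewrite inE.
  by move=> z /set1P ->; rewrite cards0; apply: dp_init.
elim/ltn_ind: m S A => m IH S A dm rS sAH sA conA clA dp.
have [/exists_inP[v vS /existsP[w /andP[vw vwA]]]|no] :=
  boolP [exists v in S, exists w, adj H v w && ([set v; w] \notin A)].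
  have [p [[pn Uvp pS] [cp AC clC]]] :=
    exists_ear sHE uH sAH sA conA clA vS vw vwA.
  have sCH := cycle_edges_sub cp.
  have cE : cycle (adj E) (v :: p) by apply: sub_cycle cp; apply: adjS.
  apply: (IH _ _ (S :|: [set x in p]) (A :|: cycle_edges (v :: p)) erefl).
  - rewrite -dm; apply: proper_card; rewrite properE setDS ?subsetUl //.
    have fC := cycle_edges_next (mem_head v p).
    apply/subsetPn; exists [set v; next (v :: p) v]; last first.
      by rewrite in_setD in_setU fC orbT.
    by rewrite in_setD (subsetP sCH) // andbT (disjointFl AC).
  - by rewrite inE rS.
  - by rewrite subUset sAH.
  - exact: edges_ear.
  - exact: connect_ear.
  - move=> D f g cD fD; rewrite !inE => /orP[fA|fC] gD.
      by rewrite (clA D f g).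
    by rewrite (clC D f g) ?orbT.
  move=> z zS; move: AC; rewrite -leq_card_setU => /eqP->.
  exact: dp_ear (dp _ vS) pn Uvp pS cE zS.
have ins v w : v \in S -> adj H v w -> w \in S /\ [set v; w] \in A.
  move=> vS vw; have vwA : [set v; w] \in A.
    apply: contraR no => vwA; apply/exists_inP; exists v => //.
    by apply/existsP; exists w; rewrite vw.
  by split=> //; apply: subsetP (sA _ vwA) _ _; rewrite set22.
have ST : S = setT.
  apply/eqP; apply: contraT => ST.
  have [|v [w [vS wS vw]]] := exit_edge conH _ ST; first by apply/set0Pn; exists r.
  by have [wS'] := ins v w vS vw; rewrite wS' in wS.
have -> : H = A.
  apply/eqP; rewrite eqEsubset sAH andbT; apply/subsetP=> f fH.
  have /eqP/cards2P[v [w [_ ef]]] := simpleE (subsetP sHE f fH).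
  by rewrite ef; apply: (ins v w _ _).2; rewrite ?ST ?inE // /adj -ef.
by rewrite -ST; apply: dp.
Qed.

End Completeness.

(** * Longest walks by relaxation *)

Section Relaxation.

Variables (n N init : nat) (cond : pred nat) (tgt wt : nat -> nat).

(* Step [c] relaxes the arc number [c], which leaves the node [c %/ n]; a table
   entry is [0] for an unreached node and the best value plus one otherwise. *)
Definition relax (tab : memory) c : memory :=
  if [&& tab (c %/ n) != 0, cond c & tab (tgt c) < tab (c %/ n) + wt c]
  then update tab (tgt c) (tab (c %/ n) + wt c) else tab.

Fixpoint relaxed c : memory :=
  if c is c'.+1 then relax (relaxed c') c' else update (fun=> 0) init 1.

Inductive walk : nat -> nat -> Prop :=
| walk_nil : walk init 0
| walk_step c k : c < N -> cond c -> walk (c %/ n) k -> walk (tgt c) (k + wt c).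

(** Asked of reachable nodes only: indices that code no state, such as an empty ear with [v]
    distinct from [w], may have arcs leading backwards. *)
Hypothesis forward : forall c k, c < N -> cond c -> walk (c %/ n) k -> c %/ n < tgt c.

Lemma relaxed_sound c i k : c <= N -> relaxed c i = k.+1 -> walk i k.
Proof.
elim: c i k => [|c IH] i k /= cN.
  by rewrite /update; case: eqP => [-> [<-]|//]; constructor.
rewrite /relax; case: and3P => [[V0 cc _]|_]; last exact: IH (ltnW cN).
rewrite /update; case: eqP => [-> e|_]; last exact: IH (ltnW cN).
have [k' e'] : exists k', relaxed c (c %/ n) = k'.+1.
  by case: (relaxed c _) V0 => // k' _; exists k'.
move: e; rewrite e' addSn => -[<-]; apply: walk_step => //.
exact: IH (ltnW cN) e'.
Qed.

Lemma relax_ge tab c i : tab i <= relax tab c i.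
Proof.
rewrite /relax; case: and3P => // -[_ _ h].
by rewrite /update; case: eqP => // ->; apply: ltnW.
Qed.

Lemma relaxed_ge c c' i : c <= c' -> relaxed c i <= relaxed c' i.
Proof.
move=> /subnKC<-; elim: (c' - c) => [|d IH]; first by rewrite addn0.
by rewrite addnS /=; apply: leq_trans IH (relax_ge _ _ _).
Qed.

(** Bounds the bit length of table entries in the running time analysis. *)
Lemma relaxed_le c i : (forall c, wt c <= 1) -> relaxed c i <= c.+1.
Proof.
move=> wt1; elim: c i => [|c IH] i /=; first by rewrite /update; case: eqP.
rewrite /relax; case: and3P => _; last exact: leqW.
rewrite /update; case: eqP => _; last exact: leqW.
by rewrite -addn1 leq_add.
Qed.

(** Arcs are numbered by increasing source, so the target of arc [c] lies beyond the sources of all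
    arcs up to [c]: a source is final once its arcs are scanned. *)
Lemma relaxed_src c c0 : c < N -> c0 <= c ->
  relaxed c.+1 (c0 %/ n) = relaxed c (c0 %/ n).
Proof.
move=> cN c0c /=; rewrite /relax; case: and3P => // -[V0 cc _].
rewrite /update; case: eqP => // e.
have [k' e'] : exists k', relaxed c (c %/ n) = k'.+1.
  by case: (relaxed c _) V0 => // k' _; exists k'.
have := forward cN cc (relaxed_sound (ltnW cN) e').
by rewrite -e ltnNge leq_div2r.
Qed.

(** Relaxing [c0] establishes the inequality; afterwards its source is frozen and its target can
    only grow. *)
Lemma relaxed_arc c c0 : c <= N -> c0 < c -> cond c0 ->
  relaxed c (c0 %/ n) != 0 ->
  relaxed c (c0 %/ n) + wt c0 <= relaxed c (tgt c0).
Proof.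
elim: c => // c IH cN; rewrite ltnS => c0c cc.
rewrite relaxed_src // => V0; move: c0c; rewrite leq_eqVlt => /predU1P[e|lt].
  rewrite -{}e {c IH} in cN V0 *.
  rewrite /= /relax V0 cc /=; case: ltnP => // _.
  by rewrite /update eqxx.
exact: leq_trans (IH (ltnW cN) lt cc V0) (relax_ge _ _ _).
Qed.

Lemma relaxed_complete i k : walk i k -> k < relaxed N i.
Proof.
elim=> {i k} [|c k cN cc _ IH].
  by apply: leq_trans (relaxed_ge _ (leq0n _)); rewrite /= /update eqxx.
have := relaxed_arc (leqnn N) cN cc.
rewrite -lt0n (leq_ltn_trans (leq0n k)) // => /(_ isT).
by apply: leq_trans; rewrite -addSn leq_add2r.
Qed.

End Relaxation.

(** * Ternary codes of states *)

Section Ternary.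

Definition digit i x := x %/ 3 ^ i %% 3.

(** Every nonzero digit becomes 1; twice this number is the code after the ear has been closed. *)
Definition support_code n x := \sum_(i < n) (digit i x != 0) * 3 ^ i.

Lemma digitS i x : digit i.+1 x = digit i (x %/ 3).
Proof. by rewrite /digit expnS divnMA. Qed.

Lemma digit_sum n (f : nat -> nat) i : (forall j, f j < 3) -> i < n ->
  digit i (\sum_(j < n) f j * 3 ^ j) = f i.
Proof.
elim: n f i => // n IH f i f3 lt_i.
have -> : \sum_(j < n.+1) f j * 3 ^ j = f 0 + (\sum_(j < n) f j.+1 * 3 ^ j) * 3.
  rewrite big_ord_recl /= expn0 muln1 big_distrl; congr (_ + _).
  by apply: eq_bigr => j _; rewrite /bump /= add1n expnSr mulnA.
case: i lt_i => [_|i lt_i].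
  by rewrite /digit expn0 divn1 addnC modnMDl modn_small.
rewrite digitS addnC divnMDl // divn_small // addn0.
exact: (IH (fun j => f j.+1)).
Qed.

(** The recurrence by which the program fills its table: for a ternary digit [d], [d.+1 %/ 2] is the
    indicator of [d != 0]. *)
Lemma support_codeE n x : x < 3 ^ n ->
  support_code n x = 3 * support_code n (x %/ 3) + (x %% 3).+1 %/ 2.
Proof.
have -> : (x %% 3).+1 %/ 2 = (x %% 3 != 0).
  by have := ltn_pmod x (isT : 0 < 3); case: (x %% 3) => [|[|[|]]].
case: n => [|n] x_lt; first by move: x_lt; rewrite /support_code !big_ord0; case: x.
rewrite {2}/support_code big_ord_recr /= {2}/digit.
rewrite (@divn_small (x %/ 3) (3 ^ n)); last first.
  by rewrite ltn_divLR // -expnSr.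
rewrite mod0n eqxx mul0n addn0 /support_code big_ord_recl /= /digit expn0 divn1 muln1.
rewrite addnC big_distrr /=; congr (_ + _); apply: eq_bigr => i _.
by rewrite -[_ %/ 3 ^ _.+1 %% 3]/(digit i.+1 x) digitS expnS mulnCA.
Qed.

End Ternary.

Lemma nth_allpairs (S T R : Type) (f : S -> T -> R) x0 y0 z0 s t i j :
  i < size s -> j < size t ->
  nth z0 (allpairs f s t) (i * size t + j) = f (nth x0 s i) (nth y0 t j).
Proof.
elim: s i => // x s IH [|i] lti ltj /=; rewrite nth_cat size_map.
  by rewrite mul0n add0n ltj (nth_map y0).
by rewrite mulSn -addnA ltnNge leq_addr /= addKn IH.
Qed.

(** * States and transitions as numbers *)

Section Codes.

Variables (n : nat) (E : {set {set 'I_n}}).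
Hypothesis simpleE : simple_graph E.
Variable r : 'I_n.
Hypothesis r0 : r = 0 :> nat.
Implicit Types (S R : {set 'I_n}) (u v w : 'I_n).

Lemma graph_input_adj v w : graph_input E (v * n + w).+1 = adj E v w.
Proof.
rewrite /graph_input /=; have := nth_allpairs
  (fun x y : 'I_n => nat_of_bool (adj E x y)) v v 0 (s := enum 'I_n)
  (t := enum 'I_n) (i := v) (j := w).
by rewrite size_enum_ord !ltn_ord !nth_ord_enum => ->.
Qed.

(* Vertices of the cactus get digit [2] and vertices of the open ear digit [1], so
   that extending or closing an ear always increases the code: scanning the codes
   in increasing order meets every state after all its predecessors. *)
Definition code S R := \sum_(i < n) (if i \in S then 2 else i \in R) * 3 ^ i.

Lemma code_digit S R u : digit u (code S R) = if u \in S then 2 else u \in R.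
Proof.
pose f i := if insub i is Some v then if v \in S then 2 else nat_of_bool (v \in R) else 0.
have fE v : f v = if v \in S then 2 else v \in R by rewrite /f valK.
rewrite -fE -(@digit_sum n f) //; last first.
  by move=> j; rewrite /f; case: insub => // v; case: (v \in S); case: (v \in R).
by rewrite /code; congr (digit _ _); apply: eq_bigr => i _; rewrite fE.
Qed.

Lemma code_extend S R u : u \notin S -> u \notin R ->
  code S (u |: R) = code S R + 3 ^ u.
Proof.
move=> uS uR; rewrite /code (bigD1 u) //= [in RHS](bigD1 u) //= (negPf uS) (negPf uR).
rewrite setU11 mul0n mul1n add0n addnC; congr (_ + _); apply: eq_bigr => i iu.
by rewrite !inE (negPf iu).
Qed.

Lemma support_code_code S R :
  support_code n (code S R) = \sum_(i < n | i \in S :|: R) 3 ^ i.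
Proof.
rewrite /support_code [RHS]big_mkcond; apply: eq_bigr => i _.
by rewrite code_digit inE; case: (i \in S); case: (i \in R); rewrite ?mul1n.
Qed.

Lemma code_set0 S : code S set0 = 2 * \sum_(i < n | i \in S) 3 ^ i.
Proof.
rewrite big_distrr big_mkcond /=; apply: eq_bigr => i _.
by rewrite inE; case: (i \in S).
Qed.

Lemma code_close S R : 2 * support_code n (code S R) = code (S :|: R) set0.
Proof. by rewrite support_code_code code_set0. Qed.

(** Closing raises exactly the digits of the ear by 1, so a subtraction isolates the ear as a
    number. *)
Lemma code_ear S R : [disjoint S & R] ->
  2 * support_code n (code S R) = code S R + \sum_(i < n | i \in R) 3 ^ i.
Proof.
move=> dSR; rewrite code_close code_set0 big_distrr /= [in LHS]big_mkcond /=.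
rewrite [X in _ = _ + X]big_mkcond -big_split /=; apply: eq_bigr => i _.
rewrite inE; have [iS|iS] /= := boolP (i \in S).
  by rewrite (disjointFr dSR iS) addn0.
by case: (i \in R); rewrite // mul1n mul2n addnn.
Qed.

(** The sum contains the term [3 ^ w] and exceeds it exactly when the ear has another vertex; this
    detects pendant edges. *)
Lemma ear_gt R w : w \in R ->
  (3 ^ w < \sum_(i < n | i \in R) 3 ^ i) = (#|R| != 1).
Proof.
move=> wR; rewrite (bigD1 w) //= -[X in X < _]addn0 ltn_add2l lt0n sum_nat_eq0.
congr (~~ _); rewrite (cardsD1 w) wR; apply/forall_inP/eqP.
  move=> h; congr (1 + _); apply/eqP; rewrite cards_eq0; apply/eqP/setP=> x.
  rewrite !inE; apply/negP=> /andP[xw xR].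
  by have := h x; rewrite xR xw expn_eq0 => /(_ isT).
case=> /eqP; rewrite cards_eq0 => /eqP e0 i /andP[iR iw].
by have := in_set0 i; rewrite -e0 !inE iR iw.
Qed.

Lemma code_lt S R : code S R < 3 ^ n.
Proof.
have -> : 3 ^ n = (\sum_(i < n) 2 * 3 ^ i).+1.
  elim: n => [|m IH]; first by rewrite big_ord0.
  by rewrite big_ord_recr /= -addSn -IH expnS -mulSn.
rewrite ltnS leq_sum // => i _; rewrite leq_mul2r expn_eq0 /=.
by case: (i \in S); case: (i \in R).
Qed.

Lemma code_setT : (code setT set0).+1 = 3 ^ n.
Proof.
rewrite code_set0 (eq_bigl predT) => [|i]; last by rewrite inE.
elim: n => [|m IH]; first by rewrite big_ord0.
by rewrite big_ord_recr mulnDr -addSn IH expnS -mulSn.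
Qed.

Definition state_index (x v w : nat) := (x * n + v) * n + w.

Definition arc_u c := c %% n.
Definition arc_w c := c %/ n %% n.
Definition arc_v c := c %/ n %/ n %% n.
Definition arc_x c := c %/ n %/ n %/ n.

(** Digit 0 says that [u] is new: the arc extends the ear and needs the edge [wu]. Otherwise the arc
    closes the ear and needs [wv]. *)
Definition arc_ok (a : memory) c :=
  a (arc_w c * n + (if digit (arc_u c) (arc_x c) == 0 then arc_u c else arc_v c)).+1 != 0.

Definition arc_tgt c :=
  if digit (arc_u c) (arc_x c) == 0
  then state_index (arc_x c + 3 ^ arc_u c) (arc_v c) (arc_u c)
  else state_index (2 * support_code n (arc_x c)) (arc_u c) (arc_u c).

Definition arc_wt c : nat :=
  if digit (arc_u c) (arc_x c) == 0 then 1
  else 3 ^ arc_w c < 2 * support_code n (arc_x c) - arc_x c.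

Lemma arc_decode (x v w u : nat) (c := state_index x v w * n + u) :
  v < n -> w < n -> u < n ->
  [/\ c %/ n = state_index x v w, arc_x c = x, arc_v c = v, arc_w c = w & arc_u c = u].
Proof.
move=> vn wn un; have n0 : 0 < n by apply: leq_ltn_trans un.
have dm a b : b < n -> (a * n + b) %/ n = a /\ (a * n + b) %% n = b.
  by move=> bn; rewrite divnMDl // divn_small // addn0 modnMDl modn_small.
have [e1 e2] := dm (state_index x v w) u un.
have [e3 e4] := dm (x * n + v) w wn; have [e5 e6] := dm x v vn.
by rewrite /arc_x /arc_v /arc_w /arc_u e1 e2 e3 e4 e5 e6.
Qed.

Lemma arc_lt (x v w u : nat) : x < 3 ^ n -> v < n -> w < n -> u < n ->
  state_index x v w * n + u < 3 ^ n * n * n * n.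
Proof.
have lt a b m : a < m -> b < n -> a * n + b < m * n.
  move=> am bn; apply: (@leq_trans (a.+1 * n)); last by rewrite leq_mul2r am orbT.
  by rewrite mulSn addnC ltn_add2r.
by move=> xn vn wn un; exact: (lt _ _ _ (lt _ _ _ (lt _ _ _ xn vn) wn) un).
Qed.

Let a := graph_input E.
Let N := 3 ^ n * n * n * n.
Let init := state_index 2 0 0.
Let walk_a := walk n N init (arc_ok a) arc_tgt arc_wt.

Lemma dp_closing S R v w k : dp_state E r S R v w k -> adj E w v ->
  w \in R /\ [disjoint S & R].
Proof.
move=> dp wv; have [A [p [_ [[Up pp lp] [dR pS _]]]]] := dp_state_sound simpleE dp.
split.
  rewrite dR inE -lp; case: (p) lp => [/= vw|b q _]; last exact: (mem_last b q).
  by rewrite vw adj_irrefl in wv.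
apply/pred0P=> x /=; apply/negP=> /andP[xS]; rewrite dR inE => /pS.
by rewrite xS.
Qed.

Lemma state_walk S R v w k : dp_state E r S R v w k ->
  walk_a (state_index (code S R) v w) k.
Proof.
elim=> {S R v w k} [|S R v w k u dp IH uS uR wu|S R v w k u dp IH uSR wv].
- have -> : code [set r] set0 = 2.
    by rewrite code_set0 (eq_bigl (pred1 r)) ?big_pred1_eq ?r0 // => i; rewrite inE.
  rewrite r0. exact: walk_nil.
- have [eq_c ex ev ew eu] := arc_decode (code S R) (ltn_ord v) (ltn_ord w) (ltn_ord u).
  set c := _ + _ in eq_c ex ev ew eu.
  have d0 : digit (arc_u c) (arc_x c) == 0.
    by rewrite ex eu code_digit (negPf uS) (negPf uR).
  have -> : state_index (code S (u |: R)) v u = arc_tgt c.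
    by rewrite /arc_tgt d0 ex ev eu code_extend.
  have -> : k.+1 = k + arc_wt c by rewrite /arc_wt d0 addn1.
  apply: walk_step; last by rewrite eq_c; apply: IH.
    exact: arc_lt (code_lt _ _) _ _ _.
  by rewrite /arc_ok d0 ew eu /a graph_input_adj wu.
have [eq_c ex ev ew eu] := arc_decode (code S R) (ltn_ord v) (ltn_ord w) (ltn_ord u).
set c := _ + _ in eq_c ex ev ew eu.
have d0 : (digit (arc_u c) (arc_x c) == 0) = false.
  by move: uSR; rewrite ex eu code_digit inE; case: (u \in S); case: (u \in R).
have -> : state_index (code (S :|: R) set0) u u = arc_tgt c.
  by rewrite /arc_tgt d0 ex eu code_close.
have [wR dSR] := dp_closing dp wv.
have -> : k + (#|R| != 1) = k + arc_wt c.
  by rewrite /arc_wt d0 ex ew (code_ear dSR) addKn ear_gt.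
apply: walk_step; last by rewrite eq_c; apply: IH.
  exact: arc_lt (code_lt _ _) _ _ _.
by rewrite /arc_ok d0 ew ev /a graph_input_adj wv.
Qed.

(** An extension adds [3 ^ u] to the code and a closing adds at least [3 ^ w]; the code is the
    leading part of the index, so its increase outweighs any change of [v] and [w]. *)
Lemma arc_state S R v w k c : dp_state E r S R v w k ->
  c %/ n = state_index (code S R) v w -> arc_ok a c ->
  c %/ n < arc_tgt c /\ exists S' R' v' w',
    dp_state E r S' R' v' w' (k + arc_wt c) /\
    arc_tgt c = state_index (code S' R') v' w'.
Proof.
move=> dp eq_i; have n0 : 0 < n by apply: leq_ltn_trans (ltn_ord r).
have ltx x y (v1 w1 v2 w2 : 'I_n) : x < y -> state_index x v1 w1 < state_index y v2 w2.
  move=> xy; apply: leq_trans (_ : y * n * n <= _); last first.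
    by apply: leq_trans (leq_addr _ _); rewrite leq_mul2r leq_addr orbT.
  apply: leq_trans (_ : (x * n + v1).+1 * n <= _).
    by rewrite /state_index mulSn [n + _]addnC ltn_add2l.
  rewrite leq_mul2r; apply/orP; right; apply: leq_trans (_ : x.+1 * n <= _).
    by rewrite /state_index mulSn [n + _]addnC ltn_add2l.
  by rewrite leq_mul2r xy orbT.
pose u := Ordinal (ltn_pmod c n0).
have def_c : c = state_index (code S R) v w * n + u.
  by rewrite -eq_i; apply: divn_eq.
have := arc_decode (code S R) (ltn_ord v) (ltn_ord w) (ltn_ord u).
rewrite -def_c => -[_ ex ev ew eu]; rewrite eq_i.
rewrite /arc_ok /arc_tgt /arc_wt /a ew ev eu ex code_digit.
case: ifP => [d0|d0].
  move: d0; case: (boolP (u \in S)) => // uS; case: (boolP (u \in R)) => // uR _.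
  rewrite graph_input_adj => wu; split.
    by apply: (ltx _ _ v w v u); rewrite -[X in X < _]addn0 ltn_add2l expn_gt0.
  exists S, (u |: R), v, u; split.
    by rewrite addn1; apply: dp_extend dp uS uR _; move: wu; case: (adj E w u).
  by rewrite code_extend.
have uSR : u \in S :|: R.
  by move: d0; rewrite inE; case: (u \in S); case: (u \in R).
rewrite graph_input_adj => wv0; have wv : adj E w v by move: wv0; case: (adj E w v).
have [wR dSR] := dp_closing dp wv.
rewrite (code_ear dSR) addKn ear_gt //; split.
  apply: (ltx _ _ v w u u); rewrite -[X in X < _]addn0 ltn_add2l (bigD1 w) //=.
  by rewrite addn_gt0 expn_gt0.
rewrite -code_ear // code_close.
by exists (S :|: R), set0, u, u; split=> //; apply: dp_close dp uSR wv.
Qed.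

Lemma walk_state i k : walk_a i k -> exists S R v w,
  dp_state E r S R v w k /\ i = state_index (code S R) v w.
Proof.
elim=> {i k} [|c k cN ok _ [S [R [v [w [dp eq_i]]]]]].
  exists [set r], set0, r, r; split; first exact: dp_init.
  rewrite r0; congr (state_index _ _ _).
  by rewrite code_set0 (eq_bigl (pred1 r)) ?big_pred1_eq ?r0 // => i; rewrite inE.
by have [_ [S' [R' [v' [w' ?]]]]] := arc_state dp eq_i ok; exists S', R', v', w'.
Qed.

Lemma walk_forward c k : c < N -> arc_ok a c -> walk_a (c %/ n) k ->
  c %/ n < arc_tgt c.
Proof.
move=> cN ok /walk_state[S [R [v [w [dp eq_i]]]]].
by have [] := arc_state dp eq_i ok.
Qed.

Let tab := relaxed n init (arc_ok a) arc_tgt arc_wt N.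

Theorem relaxed_min_deletion : (forall x y : 'I_n, connect (adj E) x y) ->
  min_cactus_deletion E (#|E|.+1 - tab (state_index (3 ^ n).-1 0 0)).
Proof.
move=> conE; rewrite -code_setT /= -{1 2}r0.
set fin := state_index _ _ _.
have compl k : dp_state E r setT set0 r r k -> k < tab fin.
  by move=> /state_walk; apply: relaxed_complete => c k'; apply: walk_forward.
have [k0 /compl] := @dp_spanning _ E r conE.
case def_k: (tab fin) => [//|k] _; rewrite subSS.
have /walk_state[S [R [v [w [dp eq_i]]]]] : walk_a fin k.
  apply: relaxed_sound (leqnn N) def_k => c k'; exact: walk_forward.
(* The vertex [r] merely completes both state indices to arc numbers, so that [arc_decode]
   applies. *)
have eq_code : code setT set0 = code S R.
  have [_ <- _ _ _] := arc_decode (code setT set0) (ltn_ord r) (ltn_ord r) (ltn_ord r).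
  have [_ <- _ _ _] := arc_decode (code S R) (ltn_ord v) (ltn_ord w) (ltn_ord r).
  by rewrite -eq_i.
have ST : S = setT.
  apply/setP=> u; have := code_digit setT set0 u; rewrite eq_code code_digit inE.
  by case: (u \in S) => //; case: (u \in R).
have [A [p [[cA sA _] [_ [_ pS dk]]]]] := dp_state_sound simpleE dp.
have p0 : p = [::].
  by case: p pS {dk} => // x p /(_ x (mem_head _ _)); rewrite ST inE.
rewrite {}p0 addn0 in dk; split.
  exists (E :\: A); last by rewrite cardsD (setIidPr sA) -dk.
  split; first exact: subsetDl.
  have -> : E :\: (E :\: A) = A by rewrite setDDr setDv set0U (setIidPr sA).
  case: cA => conA _ uA; split=> //; split.
    by rewrite card_ord; apply: leq_ltn_trans (ltn_ord r).
  by move=> x y; apply: conA; rewrite ST inE.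
(* Optimality: the remaining graph [E :\: F] is itself realised as a final state, so its size is at
   most [k]. *)
move=> F [sF [[_ conH] uH]].
have := compl _ (dp_state_complete r simpleE (subsetDl E F) conH uH).
by rewrite def_k ltnS cardsD (setIidPr sF) !leq_subLR [k + _]addnC.
Qed.

End Codes.

(** * Running time of programs *)

Section Machine.

Implicit Types (m : memory) (e : expr) (P Q : prog).

Lemma bitlen_le v l : 0 < l -> v < 2 ^ l -> bitlen v <= l.
Proof.
move=> l0; case: v => [|v] lt; first by rewrite /bitlen trunc_log0.
by rewrite /bitlen -(ltn_exp2l _ _ (isT : 1 < 2)) (leq_ltn_trans _ lt) // trunc_logP.
Qed.

(* [expr_width] and [expr_cost] bound the bit length of the value and the cost,
   both relative to the bit length [l] of the largest cell. *)
Fixpoint expr_width e : nat :=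
  match e with
  | Defs.Num c => c.+1
  | Read _ => 1
  | Bin _ e1 e2 => (expr_width e1 + expr_width e2).+1
  end.

Fixpoint expr_cost e : nat :=
  match e with
  | Defs.Num c => c.+1
  | Read a => expr_cost a + expr_width a + 1
  | Bin _ e1 e2 => expr_cost e1 + expr_cost e2 + expr_width e1 + expr_width e2
  end.

Definition bounded l m := forall b, m b < 2 ^ l.

Lemma expr_width_gt0 e : 0 < expr_width e. Proof. by case: e. Qed.

Section Bounds.

Variables (l : nat) (m : memory).
Hypotheses (l_gt0 : 0 < l) (bm : bounded l m).

(** A product multiplies the bounds, so widths add; the extra 1 in the width of [Bin] absorbs the
    factor 2 of a sum. *)
Lemma eval_lt e : eval m e < 2 ^ (l * expr_width e).
Proof.
elim: e => [c|a _|o e1 IH1 e2 IH2] /=.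
- apply: leq_trans (ltn_expl c (isT : 1 < 2)) _.
  by rewrite leq_exp2l // (leq_trans (leqnSn c)) // leq_pmull.
- by rewrite muln1.
rewrite mulnS mulnDr expnD.
set x1 := 2 ^ (l * _) in IH1 *; set x2 := 2 ^ (l * expr_width e2) in IH2.
have x0 : 2 <= 2 ^ l by rewrite -{1}(expn1 2) leq_exp2l.
have x12 : x1 * x2 = 2 ^ (l * expr_width e1 + l * expr_width e2) by rewrite expnD.
rewrite -x12; apply: (@leq_trans (2 * (x1 * x2))); last by rewrite leq_mul2r x0 orbT.
case: o => /=; nia.
Qed.

Lemma bitlen_eval e : bitlen (eval m e) <= l * expr_width e.
Proof. by apply: bitlen_le; [rewrite muln_gt0 l_gt0 expr_width_gt0 | apply: eval_lt]. Qed.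

Lemma cost_le e : cost m e <= l * expr_cost e.
Proof.
elim: e => [c|a IH|o e1 IH1 e2 IH2] /=.
- apply: bitlen_le; first by rewrite muln_gt0 l_gt0.
  apply: leq_trans (ltn_expl c (isT : 1 < 2)) _.
  by rewrite leq_exp2l // (leq_trans (leqnSn c)) // leq_pmull.
- by rewrite !mulnDr !leq_add // ?bitlen_eval // muln1 bitlen_le.
by rewrite !mulnDr !leq_add // bitlen_eval.
Qed.

Definition test_bound e := expr_cost e + expr_width e.

Lemma test_cost_le e : test_cost m e <= l * test_bound e.
Proof. by rewrite mulnDr leq_add ?cost_le ?bitlen_eval. Qed.

Lemma write_cost_le a e :
  write_cost m a e <= l * (test_bound a + test_bound e).
Proof.
rewrite /write_cost /test_bound !mulnDr.
have := cost_le a; have := cost_le e; have := bitlen_eval a; have := bitlen_eval e; lia.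
Qed.

End Bounds.

Fixpoint straight P : bool :=
  match P with
  | Seq P1 P2 | If _ P1 P2 => straight P1 && straight P2
  | While _ _ => false
  | _ => true
  end.

Fixpoint run P m : memory :=
  match P with
  | Write a e => update m (eval m a) (eval m e)
  | Seq P1 P2 => run P2 (run P1 m)
  | If e P1 P2 => if eval m e != 0 then run P1 m else run P2 m
  | _ => m
  end.

(** The factor by which the bit length of the memory may increase. For [If] the product is a crude
    bound on both branches. *)
Fixpoint growth P : nat :=
  match P with
  | Write _ e => expr_width e
  | Seq P1 P2 | If _ P1 P2 => growth P1 * growth P2
  | _ => 1
  end.

Fixpoint time_bound P : nat :=
  match P with
  | Write a e => test_bound a + test_bound e
  | Seq P1 P2 => time_bound P1 + growth P1 * time_bound P2
  | If e P1 P2 => test_bound e + (time_bound P1 + time_bound P2)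
  | _ => 1
  end.

Lemma growth_gt0 P : 0 < growth P.
Proof.
by elim: P => //= [_ e|P1 IH1 P2 IH2|_ P1 IH1 P2 IH2];
  rewrite ?expr_width_gt0 // muln_gt0 IH1.
Qed.

Lemma boundedW l l' m : l <= l' -> bounded l m -> bounded l' m.
Proof. by move=> ll bm b; apply: leq_trans (bm b) _; rewrite leq_exp2l. Qed.

Lemma run_bounded l P m : 0 < l -> bounded l m -> bounded (l * growth P) (run P m).
Proof.
elim: P l m => [|a e|P1 IH1 P2 IH2|e P1 IH1 P2 IH2|e P _] l m l0 bm /=;
  rewrite ?muln1 //.
- move=> b; rewrite /update; case: eqP => _; first exact: eval_lt.
  by apply: boundedW bm b; rewrite leq_pmulr ?expr_width_gt0.
- by rewrite mulnA; apply: IH2; rewrite ?muln_gt0 ?l0 ?growth_gt0 //; apply: IH1.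
case: ifP => _; [apply: boundedW (IH1 _ _ l0 bm)|apply: boundedW (IH2 _ _ l0 bm)];
  by rewrite leq_mul2l ?leq_pmulr ?leq_pmull ?growth_gt0 ?orbT.
Qed.

Lemma exec_run l P m : 0 < l -> bounded l m -> straight P ->
  exists2 t, exec P m (run P m) t & t <= l * time_bound P.
Proof.
elim: P l m => [|a e|P1 IH1 P2 IH2|e P1 IH1 P2 IH2|e P _] l m l0 bm //=.
- by move=> _; exists 1; [constructor | rewrite muln1].
- move=> _; exists (write_cost m a e); [constructor | exact: write_cost_le].
- case/andP=> s1 s2; have [t1 x1 le1] := IH1 _ _ l0 bm s1.
  have lg0 : 0 < l * growth P1 by rewrite muln_gt0 l0 growth_gt0.
  have [t2 x2 le2] := IH2 _ _ lg0 (run_bounded P1 l0 bm) s2.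
  exists (t1 + t2); first exact: exec_seq x1 x2.
  by rewrite mulnDr leq_add // mulnA.
case/andP=> s1 s2; have le0 := test_cost_le l0 bm e.
case: ifPn => [n0|/negPn/eqP e0].
  have [t x le] := IH1 _ _ l0 bm s1; exists (test_cost m e + t).
    exact: exec_if_true.
  by rewrite mulnDr (leq_add le0) // (leq_trans le) // leq_mul2l leq_addr orbT.
have [t x le] := IH2 _ _ l0 bm s2; exists (test_cost m e + t).
  exact: exec_if_false.
by rewrite mulnDr (leq_add le0) // (leq_trans le) // leq_mul2l leq_addl orbT.
Qed.

Definition runs_within (pre : memory -> Prop) P (post : memory -> Prop) T :=
  forall m, pre m -> exists m' t, [/\ exec P m m' t, post m' & t <= T].

Lemma runs_within_straight l pre P post : 0 < l -> straight P ->
  (forall m, pre m -> bounded l m /\ post (run P m)) ->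
  runs_within pre P post (l * time_bound P).
Proof.
move=> l0 sP h m /h[bm pm]; have [t x le] := exec_run l0 bm sP.
by exists (run P m), t.
Qed.

Lemma runs_within_seq pre mid post P Q T1 T2 :
  runs_within pre P mid T1 -> runs_within mid Q post T2 ->
  runs_within pre (Seq P Q) post (T1 + T2).
Proof.
move=> hP hQ m /hP[m1 [t1 [x1 /hQ[m2 [t2 [x2 pm2 le2]]] le1]]].
by exists m2, (t1 + t2); split; rewrite ?leq_add //; apply: exec_seq x1 x2.
Qed.

(** Iterating [growth] would give an exponential bit length, so the invariant has to provide the
    bound [l] afresh in each round. The successor in [N.+1] pays for the last, failing test. *)
Lemma runs_within_while l (I : nat -> memory -> Prop) e P N T : 0 < l ->
  (forall i m, i <= N -> I i m -> bounded l m /\ (eval m e != 0) = (i < N)) ->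
  (forall i, i < N -> runs_within (I i) P (I i.+1) T) ->
  runs_within (I 0) (While e P) (I N) (N.+1 * (l * test_bound e + T)).
Proof.
move=> l0 hI hP.
suff loop d i m : i + d = N -> I i m ->
    exists m' t, [/\ exec (While e P) m m' t, I N m' &
                      t <= d.+1 * (l * test_bound e + T)].
  by move=> m; apply: loop.
elim: d i m => [|d IH] i m def_N Im.
  rewrite addn0 in def_N; subst i; have [bm] := hI _ _ (leqnn N) Im.
  rewrite ltnn => /negbFE/eqP e0; exists m, (test_cost m e); split=> //.
    exact: exec_while_false.
  by rewrite mul1n (leq_trans (test_cost_le l0 bm e)) // leq_addr.
have iN : i < N by rewrite -def_N -addSnnS leq_addr.
have [bm] := hI _ _ (ltnW iN) Im; rewrite iN => n0.
have [m1 [t1 [x1 I1 le1]]] := hP i iN m Im.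
have [|m2 [t2 [x2 I2 le2]]] := IH i.+1 m1 _ I1; first by rewrite addSnnS.
exists m2, (test_cost m e + t1 + t2); split=> //; first exact: exec_while_true n0 x1 x2.
by rewrite mulSn !leq_add // test_cost_le.
Qed.

End Machine.

(** Handshake by double counting: row [x] of the matrix sums to the degree of [x]. The program
    obtains the number of edges this way. *)
Lemma sum_graph_input n (E : {set {set 'I_n}}) : simple_graph E ->
  \sum_(k < n * n) graph_input E k.+1 = #|E| * 2.
Proof.
move=> simpleE.
pose s := [seq nat_of_bool (adj E x y) | x <- enum 'I_n, y <- enum 'I_n].
have -> : \sum_(k < n * n) graph_input E k.+1 = \sum_(i <- s) i.
  by rewrite (big_nth 0) big_mkord /s size_allpairs size_enum_ord.
have -> : \sum_(i <- s) i = \sum_(x : 'I_n) #|edges_at E x|.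
  rewrite /s big_allpairs_dep big_enum /=; apply: eq_bigr => x _; rewrite big_enum /=.
  have -> : edges_at E x = [set [set x; y] | y in [set y | adj E x y]].
    apply/setP=> f; rewrite inE; apply/andP/imsetP=> [[fE xf]|[y]]; last first.
      by rewrite inE => xy ->; rewrite set21.
    have /eqP/cards2P[p [q [_ def_f]]] := simpleE _ fE.
    move: xf; rewrite def_f in fE *; case/set2P=> ->; first by exists q; rewrite ?inE.
    by exists p; [rewrite inE adj_sym | exact: setUC].
  rewrite card_in_imset => [|y z _ _]; last exact: set2_injr.
  by rewrite -sum1_card [RHS]big_mkcond; apply: eq_bigr => y _; rewrite inE; case: adj.
under eq_bigr => x _ do rewrite -sum1_card big_mkcond.
rewrite exchange_big /= (bigID [in E]) /= [X in _ + X]big1 ?addn0 => [|f fE]; last first.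
  by apply: big1 => x _; rewrite inE (negPf fE).
rewrite -sum_nat_const; apply: eq_bigr => f fE.
rewrite -(simpleE f fE) -sum1_card [RHS]big_mkcond.
by apply: eq_bigr => x _; rewrite inE fE.
Qed.

(** * The program *)

Definition nvar := Read (Defs.Num 0).

(* Beyond the input, the memory holds four interleaved tables: table [0] for the
   variables (loop counter and edge count), [1] for the powers of three, [2] for
   the support codes and [3] for the values of the states. *)
Definition cell k e :=
  Bin Add (Bin Add (Bin Mul nvar nvar) (Defs.Num k.+1)) (Bin Mul (Defs.Num 4) e).
Definition table k e := Read (cell k e).

Definition counter := table 0 (Defs.Num 0).
Definition degree_sum := table 0 (Defs.Num 1).
Definition set_counter e := Write (cell 0 (Defs.Num 0)) e.
Definition next_counter := set_counter (Bin Add counter (Defs.Num 1)).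
Definition modulo e1 e2 := Bin Defs.Sub e1 (Bin Mul (Bin Div e1 e2) e2).

(** Like all loop tests below, a truncated difference, nonzero exactly while the counter is below
    its limit. *)
Definition degree_test := Bin Defs.Sub (Bin Mul nvar nvar) counter.
Definition degree_body :=
  Seq (Write (cell 0 (Defs.Num 1))
         (Bin Add degree_sum (Read (Bin Add counter (Defs.Num 1)))))
    next_counter.

Definition power_init :=
  Seq (set_counter (Defs.Num 0)) (Write (cell 1 (Defs.Num 0)) (Defs.Num 1)).

Definition power_test := Bin Defs.Sub nvar counter.
Definition power_body :=
  Seq (Write (cell 1 (Bin Add counter (Defs.Num 1)))
         (Bin Mul (Defs.Num 3) (table 1 counter)))
    next_counter.

Definition support_init := set_counter (Defs.Num 0).
Definition support_test := Bin Defs.Sub (table 1 nvar) counter.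
Definition support_body :=
  Seq (Write (cell 2 counter)
         (Bin Add
            (Bin Mul (Defs.Num 3) (table 2 (Bin Div counter (Defs.Num 3))))
            (Bin Div (Bin Add (modulo counter (Defs.Num 3)) (Defs.Num 1))
               (Defs.Num 2))))
    next_counter.

(* The single counter of the main loop is [((x * n + v) * n + w) * n + u]: [x] codes
   the vertex sets, [v] and [w] are the ends of the open ear, and [u] is the vertex
   it is extended by or, if [u] is already present, the next starting point. *)
Definition u_expr := modulo counter nvar.
Definition state_expr := Bin Div counter nvar.
Definition w_expr := modulo state_expr nvar.
Definition v_expr := modulo (Bin Div state_expr nvar) nvar.
Definition x_expr := Bin Div (Bin Div state_expr nvar) nvar.
Definition index_expr x v w := Bin Add (Bin Mul (Bin Add (Bin Mul x nvar) v) nvar) w.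
Definition adj_expr v w := Read (Bin Add (Bin Add (Bin Mul v nvar) w) (Defs.Num 1)).
Definition closed_expr := Bin Mul (Defs.Num 2) (table 2 x_expr).

Definition relax_prog ok tgt wt :=
  If ok
    (If (Bin Defs.Sub (Bin Add (table 3 state_expr) wt) (table 3 tgt))
       (Write (cell 3 tgt) (Bin Add (table 3 state_expr) wt)) Skip)
    Skip.

Definition state_init :=
  Seq (set_counter (Defs.Num 0))
    (Write (cell 3 (index_expr (Defs.Num 2) (Defs.Num 0) (Defs.Num 0)))
       (Defs.Num 1)).
Definition arc_test :=
  Bin Defs.Sub (Bin Mul (Bin Mul (Bin Mul (table 1 nvar) nvar) nvar) nvar) counter.
(** The pattern [1 - (1 - d)] maps every positive [d] to 1, turning the comparison in [arc_wt] into
    a number. *)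
Definition relax_arc :=
  If (table 3 state_expr)
    (If (modulo (Bin Div x_expr (table 1 u_expr)) (Defs.Num 3))
       (relax_prog (adj_expr w_expr v_expr)
          (index_expr closed_expr u_expr u_expr)
          (Bin Defs.Sub (Defs.Num 1) (Bin Defs.Sub (Defs.Num 1)
             (Bin Defs.Sub (Bin Defs.Sub closed_expr x_expr) (table 1 w_expr)))))
       (relax_prog (adj_expr w_expr u_expr)
          (index_expr (Bin Add x_expr (table 1 u_expr)) v_expr u_expr)
          (Defs.Num 1)))
    Skip.

Definition arc_body := Seq relax_arc next_counter.

Definition answer :=
  Bin Defs.Sub (Bin Add (Bin Div degree_sum (Defs.Num 2)) (Defs.Num 1))
    (table 3 (index_expr (Bin Defs.Sub (table 1 nvar) (Defs.Num 1))
                (Defs.Num 0) (Defs.Num 0))).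

Definition write_answer := Write (Defs.Num 0) answer.

Definition cactus_prog :=
  Seq (While degree_test degree_body)
    (Seq power_init
    (Seq (While power_test power_body)
    (Seq support_init
    (Seq (While support_test support_body)
    (Seq state_init
    (Seq (While arc_test arc_body)
       write_answer)))))).

(** * Memory layout and evaluation of expressions *)

Section Layout.

Variables (n : nat) (E : {set {set 'I_n}}).
Let a := graph_input E.

Definition tables (c s : nat) (pw sp tb : memory) (k : nat) : memory :=
  match k with
  | 0 => fun i => if i is i'.+1 then (if i' is 0 then s else 0) else c
  | 1 => pw
  | 2 => sp
  | _ => tb
  end.

Definition layout (f : nat -> memory) : memory := fun b =>
  if b <= n * n then a b else f ((b - (n * n).+1) %% 4) ((b - (n * n).+1) %/ 4).

Implicit Types (m pw sp tb : memory) (f g : nat -> memory) (e : expr).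

Lemma layout_ext f g : (forall k, k < 4 -> f k =1 g k) -> layout f =1 layout g.
Proof. by move=> fg b; rewrite /layout; case: ifP => // _; rewrite fg // ltn_pmod. Qed.

Lemma layout_input f b : b <= n * n -> layout f b = a b.
Proof. by rewrite /layout => ->. Qed.

Lemma layout_cell f k i : k < 4 -> layout f (n * n + k.+1 + 4 * i) = f k i.
Proof.
move=> k4; rewrite /layout leqNgt addnS addSn ltnS -addnA leq_addr /=.
by rewrite subSS addKn addnC mulnC modnMDl divnMDl // divn_small // modn_small // addn0.
Qed.

Lemma layout_update f m k i v : m =1 layout f -> k < 4 ->
  update m (n * n + k.+1 + 4 * i) v =1
    layout (fun k' => if k' == k then update (f k) i v else f k').
Proof.
move=> mf k4 b; rewrite /update; case: eqP => [->|ne].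
  by rewrite layout_cell // eqxx /update eqxx.
rewrite mf /layout; case: leqP => // lt; case: eqP => // e1.
rewrite e1 /update; case: eqP => // e2; case: ne.
rewrite -(subnKC lt) {1}(divn_eq (b - _) 4) e1 e2; lia.
Qed.

Section Eval.

Variables (m : memory) (f : nat -> memory).
Hypothesis mf : m =1 layout f.

Lemma eval_nvar : eval m nvar = n.
Proof. by rewrite /= mf layout_input. Qed.

Lemma eval_cell k e : eval m (cell k e) = n * n + k.+1 + 4 * eval m e.
Proof. by rewrite -[in RHS]eval_nvar. Qed.

Lemma eval_table k e : k < 4 -> eval m (table k e) = f k (eval m e).
Proof. by move=> k4; rewrite -(layout_cell f _ k4) -mf -eval_cell. Qed.

Lemma eval_modulo e1 e2 : eval m (modulo e1 e2) = eval m e1 %% eval m e2.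
Proof. by rewrite /= {1}(divn_eq (eval m e1) (eval m e2)) addKn. Qed.

Lemma eval_index x v w :
  eval m (index_expr x v w) = state_index n (eval m x) (eval m v) (eval m w).
Proof. by rewrite /state_index -{1 2}eval_nvar. Qed.

End Eval.

Lemma update_table f m k e1 e2 g : m =1 layout f -> k < 4 ->
  update (f k) (eval m e1) (eval m e2) =1 g k ->
  (forall k', k' < 4 -> k' != k -> f k' =1 g k') ->
  run (Write (cell k e1) e2) m =1 layout g.
Proof.
move=> mf k4 gk gk' b.
rewrite -[run _ _]/(update m (eval m (cell k e1)) (eval m e2)) (eval_cell mf).
rewrite (layout_update _ _ mf k4); apply: layout_ext => k' k'4; case: eqP => [->//|/eqP ne].
exact: gk'.
Qed.

End Layout.

(** * Correctness and running time of each phase *)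

Section Correctness.

Variables (n : nat) (E : {set {set 'I_n}}).
Hypothesis n_gt0 : 0 < n.
Hypothesis simpleE : simple_graph E.
Let a := graph_input E.
Implicit Types (m pw sp tb : memory) (e : expr) (c s : nat).

Definition holds c s pw sp tb m := m =1 layout E (tables c s pw sp tb).

Lemma run_seq P Q m : run (Seq P Q) m = run Q (run P m).
Proof. by []. Qed.

Lemma run_set_counter m c s pw sp tb e : holds c s pw sp tb m ->
  holds (eval m e) s pw sp tb (run (set_counter e) m).
Proof.
by move=> hm; apply: (update_table hm) => // [[|i]|[|[|[|k]]]].
Qed.

Lemma run_next_counter m c s pw sp tb : holds c s pw sp tb m ->
  holds c.+1 s pw sp tb (run next_counter m).
Proof.
move=> hm; have := run_set_counter (Bin Add counter (Defs.Num 1)) hm.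
rewrite -[eval _ (Bin _ _ _)]/(eval m counter + 1) (eval_table hm) // addn1.
exact.
Qed.

Lemma run_write_sum m c s pw sp tb e : holds c s pw sp tb m ->
  holds c (eval m e) pw sp tb (run (Write (cell 0 (Defs.Num 1)) e) m).
Proof.
by move=> hm; apply: (update_table hm) => // [[|[|i]]|[|[|[|k]]]].
Qed.

Lemma run_write_power m c s pw sp tb pw' e1 e2 : holds c s pw sp tb m ->
  update pw (eval m e1) (eval m e2) =1 pw' ->
  holds c s pw' sp tb (run (Write (cell 1 e1) e2) m).
Proof.
by move=> hm eq_pw; apply: (update_table hm) => // -[|[|[|k]]].
Qed.

Lemma run_write_support m c s pw sp tb sp' e1 e2 : holds c s pw sp tb m ->
  update sp (eval m e1) (eval m e2) =1 sp' ->
  holds c s pw sp' tb (run (Write (cell 2 e1) e2) m).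
Proof.
by move=> hm eq_sp; apply: (update_table hm) => // -[|[|[|k]]].
Qed.

Lemma run_write_state m c s pw sp tb tb' e1 e2 : holds c s pw sp tb m ->
  update tb (eval m e1) (eval m e2) =1 tb' ->
  holds c s pw sp tb' (run (Write (cell 3 e1) e2) m).
Proof.
by move=> hm eq_tb; apply: (update_table hm) => // -[|[|[|[|k]]]].
Qed.

Let N := 3 ^ n * n * n * n.
Let l := 6 * n.

Lemma l_gt0 : 0 < l. Proof. by rewrite muln_gt0. Qed.

(** Origin of the 6 in [l]: with [t = 2 ^ n], [3 ^ n] costs two factors [t], [n ^ 3] costs three,
    and the sixth absorbs the successor. *)
Lemma N_lt : N.+1 < 2 ^ l.
Proof.
set t := 2 ^ n; have n2 : n < t by apply: ltn_expl.
have t2 : 2 <= t by rewrite /t -{1}(expn1 2) leq_exp2l.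
have le4 : 3 ^ n <= t * t by rewrite -expnMn leq_exp2r.
have -> : 2 ^ l = t * (t * t * (t * t * t)).
  by rewrite /l mulnC expnM -/t !expnS expn0 muln1 !mulnA.
have lt5 : N < t * t * (t * t * t).
  have -> : N = 3 ^ n * (n * n * n) by rewrite /N !mulnA.
  apply: leq_ltn_trans (leq_mul le4 (leqnn _)) _.
  rewrite ltn_pmul2l ?muln_gt0 ?(ltnW t2) //.
  by rewrite !ltn_mul.
by apply: leq_ltn_trans lt5 _; rewrite ltn_Pmull // !muln_gt0 (ltnW t2).
Qed.

Lemma graph_input_le1 k : k < n * n -> a k.+1 <= 1.
Proof.
move=> kn; have vn : k %/ n < n by rewrite ltn_divLR.
have := graph_input_adj E (Ordinal vn) (Ordinal (ltn_pmod k n_gt0)).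
by rewrite /= -divn_eq /a => ->; case: adj.
Qed.

Lemma nn_le : n * n <= N.
Proof. by rewrite /N -mulnA leq_pmull // muln_gt0 n_gt0 expn_gt0. Qed.

Lemma graph_input_le b : b <= n * n -> a b <= N.
Proof.
case: b => [_|b bn]; last first.
  by apply: leq_trans (graph_input_le1 bn) (leq_trans _ nn_le); rewrite muln_gt0 n_gt0.
by apply: leq_trans nn_le; rewrite leq_pmulr.
Qed.

Lemma holds_bounded c s pw sp tb m : holds c s pw sp tb m ->
  c <= N -> s <= N -> (forall i, pw i <= N) -> (forall i, sp i <= N) ->
  (forall i, tb i <= N.+1) -> bounded l m.
Proof.
move=> hm cN sN pwN spN tbN b; apply: leq_ltn_trans N_lt; rewrite hm /layout.
case: (leqP b (n * n)) => [le|_]; first by apply: leqW; apply: graph_input_le.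
case: (_ %% 4) => [|[|[|k]]] /=; [|exact: leqW|exact: leqW|by []].
by case: (_ %/ 4) => [|[|i]] //=; apply: leqW.
Qed.

Let zero : memory := fun=> 0.

(** Partially filled tables for the loop invariants. Index [j] is included because entry 0 is
    written before the loop starts. *)
Definition powers j : memory := fun i => if i <= j then 3 ^ i else 0.
Definition supports j : memory := fun x => if x < j then support_code n x else 0.

Lemma powers_le j i : j <= n -> powers j i <= N.
Proof.
move=> jn; rewrite /powers; case: (leqP i j) => // ij.
apply: leq_trans (_ : 3 ^ n <= _); first by rewrite leq_exp2l // (leq_trans ij).
by rewrite /N -!mulnA leq_pmulr // !muln_gt0 n_gt0.
Qed.

Lemma support_code_lt x : support_code n x < 3 ^ n.
Proof.
have := code_lt set0 [set i : 'I_n | digit i x != 0].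
rewrite /code; under eq_bigr => i _ do rewrite !inE.
exact.
Qed.

Lemma supports_le j x : supports j x <= N.
Proof.
rewrite /supports; case: (ltnP x j) => // _; apply: leq_trans (ltnW (support_code_lt x)) _.
by rewrite /N -!mulnA leq_pmulr // !muln_gt0 n_gt0.
Qed.

Lemma degree_partial_le i : i <= n * n -> \sum_(k < i) a k.+1 <= N.
Proof.
move=> iN; apply: leq_trans (leq_trans iN nn_le).
rewrite -[leqRHS]card_ord -sum1_card leq_sum // => k _.
by apply: graph_input_le1; apply: leq_trans iN.
Qed.

Lemma degree_loop_correct :
  runs_within (holds 0 0 zero zero zero) (While degree_test degree_body)
    (holds (n * n) (#|E| * 2) zero zero zero)
    ((n * n).+1 * (l * test_bound degree_test + l * time_bound degree_body)).
Proof.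
rewrite -sum_graph_input //.
pose I i := holds i (\sum_(k < i) a k.+1) zero zero zero.
have bI i m : i <= n * n -> I i m -> bounded l m.
  move=> iN Im; apply: (holds_bounded Im) => //; first exact: leq_trans iN nn_le.
  exact: degree_partial_le.
have := @runs_within_while l I; rewrite /I big_ord0; apply; first exact: l_gt0.
  move=> i m iN Im; split; first exact: bI Im.
  rewrite -[eval _ _]/(eval m nvar * eval m nvar - eval m counter).
  by rewrite !(eval_nvar Im) (eval_table Im) //= subn_eq0 -ltnNge.
move=> i iN; apply: runs_within_straight l_gt0 _ _ => // m Im.
split; first exact: bI (ltnW iN) Im.
rewrite run_seq; apply: run_next_counter.
have := run_write_sum (Bin Add degree_sum (Read (Bin Add counter (Defs.Num 1)))) Im.
rewrite -[eval _ (Bin _ _ _)]/(eval m degree_sum + m (eval m counter + 1)).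
rewrite !(eval_table Im) //= Im layout_input ?addn1 // big_ord_recr /=.
exact.
Qed.

Let S := #|E| * 2.

Lemma S_le : S <= N.
Proof. by rewrite /S -(sum_graph_input simpleE); apply: degree_partial_le. Qed.

Lemma holds_ext c s pw sp tb sp' tb' m : sp =1 sp' -> tb =1 tb' ->
  holds c s pw sp tb m -> holds c s pw sp' tb' m.
Proof.
by move=> es et hm b; rewrite hm; apply: layout_ext => -[|[|[|k]]].
Qed.

Lemma power_init_correct :
  runs_within (holds (n * n) S zero zero zero) power_init
    (holds 0 S (powers 0) zero zero) (l * time_bound power_init).
Proof.
apply: runs_within_straight l_gt0 _ _ => // m hm; split.
  by apply: (holds_bounded hm) => //; [exact: nn_le | exact: S_le].
apply: (run_write_power (run_set_counter (Defs.Num 0) hm)) => i.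
by rewrite /update /powers /=; case: i.
Qed.

Lemma power_loop_correct :
  runs_within (holds 0 S (powers 0) zero zero) (While power_test power_body)
    (holds n S (powers n) zero zero)
    (n.+1 * (l * test_bound power_test + l * time_bound power_body)).
Proof.
pose I i := holds i S (powers i) zero zero.
have bI i m : i <= n -> I i m -> bounded l m.
  move=> iN Im; apply: (holds_bounded Im) => //; last by move=> j; apply: powers_le.
    by apply: leq_trans iN (leq_trans _ nn_le); rewrite leq_pmulr.
  exact: S_le.
apply: (@runs_within_while l I); first exact: l_gt0.
  move=> i m iN Im; split; first exact: bI Im.
  rewrite -[eval _ _]/(eval m nvar - eval m counter).
  by rewrite !(eval_nvar Im) (eval_table Im) //= subn_eq0 -ltnNge.
move=> i iN; apply: runs_within_straight l_gt0 _ _ => // m Im.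
split; first exact: bI (ltnW iN) Im.
rewrite run_seq; apply: run_next_counter; apply: (run_write_power Im) => j.
rewrite -[eval _ (Bin Add _ _)]/(eval m counter + 1).
rewrite -[eval _ (Bin Mul _ _)]/(3 * eval m (table 1 counter)).
rewrite !(eval_table Im) //= /update /powers leqnn addn1 -expnS [j <= _.+1]leq_eqVlt.
by case: eqP => [->|].
Qed.

Lemma support_init_correct :
  runs_within (holds n S (powers n) zero zero) support_init
    (holds 0 S (powers n) (supports 0) zero) (l * time_bound support_init).
Proof.
apply: runs_within_straight l_gt0 _ _ => // m hm; split.
  apply: (holds_bounded hm) => //; [ | exact: S_le | ].
    by apply: leq_trans nn_le; rewrite leq_pmulr.
  by move=> j; apply: powers_le.
exact: holds_ext (run_set_counter (Defs.Num 0) hm).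
Qed.

Lemma pow3_le : 3 ^ n <= N.
Proof. by rewrite /N -!mulnA leq_pmulr // !muln_gt0 n_gt0. Qed.

Lemma support_loop_correct :
  runs_within (holds 0 S (powers n) (supports 0) zero) (While support_test support_body)
    (holds (3 ^ n) S (powers n) (supports (3 ^ n)) zero)
    ((3 ^ n).+1 * (l * test_bound support_test + l * time_bound support_body)).
Proof.
pose I i := holds i S (powers n) (supports i) zero.
have bI i m : i <= 3 ^ n -> I i m -> bounded l m.
  move=> iN Im; apply: (holds_bounded Im) => //.
  - exact: leq_trans iN pow3_le.
  - exact: S_le.
  - by move=> j; apply: powers_le.
  exact: supports_le.
apply: (@runs_within_while l I); first exact: l_gt0.
  move=> i m iN Im; split; first exact: bI Im.
  rewrite -[eval _ _]/(eval m (table 1 nvar) - eval m counter).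
  by rewrite !(eval_table Im) // (eval_nvar Im) /= /powers leqnn subn_eq0 -ltnNge.
move=> i iN; apply: runs_within_straight l_gt0 _ _ => // m Im.
split; first exact: bI (ltnW iN) Im.
rewrite run_seq; apply: run_next_counter; apply: (run_write_support Im) => j.
rewrite -[eval _ (Bin Add _ _)]/(3 * eval m (table 2 (Bin Div counter (Defs.Num 3))) +
  (eval m (modulo counter (Defs.Num 3)) + 1) %/ 2).
rewrite !(eval_table Im) // (eval_modulo m).
rewrite -[eval _ (Bin Div _ _)]/(eval m counter %/ 3) (eval_table Im) //=.
rewrite /update /supports ltnS [j <= _]leq_eqVlt; case: eqP => [->|] //=.
rewrite addn1 (support_codeE iN); congr (3 * _ + _).
(* The entry at [i %/ 3] is already filled unless [i = 0]; then the still empty entry 0 is read,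
   whose default [0] is the correct value. *)
case: i {iN Im} => [|i]; last by rewrite ltn_Pdiv.
by rewrite div0n ltnn /support_code big1 // => k _; rewrite /digit div0n mod0n.
Qed.

Let tab := relaxed n (state_index n 2 0 0) (arc_ok n a) (arc_tgt n) (arc_wt n).

Lemma state_init_correct :
  runs_within (holds (3 ^ n) S (powers n) (supports (3 ^ n)) zero) state_init
    (holds 0 S (powers n) (supports (3 ^ n)) (tab 0)) (l * time_bound state_init).
Proof.
apply: runs_within_straight l_gt0 _ _ => // m hm; split.
  apply: (holds_bounded hm) => //; [exact: pow3_le | exact: S_le | | exact: supports_le].
  by move=> j; apply: powers_le.
have hm' := run_set_counter (Defs.Num 0) hm.
by apply: (run_write_state hm') => i; rewrite (eval_index hm').
Qed.

Lemma arc_wt_le1 c : arc_wt n c <= 1.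
Proof. by rewrite /arc_wt; case: ifP => // _; apply: leq_b1. Qed.

Lemma states_bounded c m : c <= N ->
  holds c S (powers n) (supports (3 ^ n)) (tab c) m -> bounded l m.
Proof.
move=> cN Im; apply: (holds_bounded Im) => //.
- exact: S_le.
- by move=> j; apply: powers_le.
- exact: supports_le.
move=> i; apply: (@leq_trans c.+1) => //; apply: relaxed_le; exact: arc_wt_le1.
Qed.

Lemma relax_arc_correct c m : c < N ->
  holds c S (powers n) (supports (3 ^ n)) (tab c) m ->
  holds c S (powers n) (supports (3 ^ n)) (tab c.+1) (run relax_arc m).
Proof.
move=> cN Im.
have Ec : eval m counter = c by rewrite (eval_table Im).
have En := eval_nvar Im.
have Es : eval m state_expr = c %/ n.
  by rewrite -[eval _ _]/(eval m counter %/ eval m nvar) Ec En.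
have Eu : eval m u_expr = arc_u n c by rewrite eval_modulo Ec En.
have Ew : eval m w_expr = arc_w n c by rewrite eval_modulo Es En.
have Ev : eval m v_expr = arc_v n c.
  by rewrite eval_modulo -[eval _ (Bin _ _ _)]/(eval m state_expr %/ eval m nvar) Es En.
have Ex : eval m x_expr = arc_x n c.
  by rewrite -[eval _ _]/(eval m state_expr %/ eval m nvar %/ eval m nvar) Es En.
have un : arc_u n c < n by apply: ltn_pmod.
have wn : arc_w n c < n by apply: ltn_pmod.
have vn : arc_v n c < n by apply: ltn_pmod.
have xn : arc_x n c < 3 ^ n by rewrite /arc_x !ltn_divLR.
have Eadj e1 e2 i j : eval m e1 = i -> eval m e2 = j -> i < n -> j < n ->
    eval m (adj_expr e1 e2) = a (i * n + j).+1.
  move=> E1 E2 lt_i lt_j.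
  rewrite -[eval _ _]/(m (eval m e1 * eval m nvar + eval m e2 + 1)) E1 E2 En addn1 Im.
  rewrite layout_input //; apply: (@leq_trans (i.+1 * n)).
    by rewrite mulSn [n + _]addnC ltn_add2l.
  by rewrite leq_mul2r lt_i orbT.
have Epw e i : eval m e = i -> i < n -> eval m (table 1 e) = 3 ^ i.
  by move=> E1 lt_i; rewrite (eval_table Im) // E1 /= /powers (ltnW lt_i).
have Ecl : eval m closed_expr = 2 * support_code n (arc_x n c).
  by rewrite -[eval _ _]/(2 * eval m (table 2 x_expr)) (eval_table Im) // Ex /= /supports xn.
have E3 e : eval m (table 3 e) = tab c (eval m e) by rewrite (eval_table Im).
have tabS : tab c.+1 = relax n (arc_ok n a) (arc_tgt n) (arc_wt n) (tab c) c by [].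
have relaxE ok tgt wt : (eval m ok != 0) = arc_ok n a c -> eval m tgt = arc_tgt n c ->
    eval m wt = arc_wt n c -> tab c (c %/ n) != 0 ->
    holds c S (powers n) (supports (3 ^ n)) (tab c.+1) (run (relax_prog ok tgt wt) m).
  move=> Eok Etgt Ewt V0.
  rewrite tabS /relax V0 -Eok -[run _ m]/(if eval m ok != 0 then
    (if eval m (table 3 state_expr) + eval m wt - eval m (table 3 tgt) != 0
     then run (Write (cell 3 tgt) (Bin Add (table 3 state_expr) wt)) m else m) else m).
  rewrite !E3 Es Etgt Ewt subn_eq0 -ltnNge andTb.
  case: (eval m ok != 0); rewrite ?andTb ?andFb //.
  case: ifP => // _; apply: (run_write_state Im) => i.
  rewrite -[eval _ (Bin _ _ _)]/(eval m (table 3 state_expr) + eval m wt).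
  by rewrite E3 Es Etgt Ewt.
rewrite -[run _ m]/(if eval m (table 3 state_expr) != 0 then
  if eval m (modulo (Bin Div x_expr (table 1 u_expr)) (Defs.Num 3)) != 0
  then run (relax_prog (adj_expr w_expr v_expr)
          (index_expr closed_expr u_expr u_expr)
          (Bin Defs.Sub (Defs.Num 1) (Bin Defs.Sub (Defs.Num 1)
             (Bin Defs.Sub (Bin Defs.Sub closed_expr x_expr) (table 1 w_expr))))) m
  else run (relax_prog (adj_expr w_expr u_expr)
          (index_expr (Bin Add x_expr (table 1 u_expr)) v_expr u_expr)
          (Defs.Num 1)) m
  else m).
rewrite E3 Es; case: ifPn => V0; last first.
  by rewrite tabS /relax (negPf V0).
have -> : eval m (modulo (Bin Div x_expr (table 1 u_expr)) (Defs.Num 3)) =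
    digit (arc_u n c) (arc_x n c).
  rewrite eval_modulo -[eval _ (Bin _ _ _)]/(eval m x_expr %/ eval m (table 1 u_expr)).
  by rewrite Ex (Epw _ _ Eu un).
case: ifP => d0; apply: relaxE => //;
  rewrite /arc_ok /arc_tgt /arc_wt ?(negPf d0) ?(negbFE d0).
- by rewrite (Eadj _ _ _ _ Ew Ev).
- by rewrite (eval_index Im) Ecl Eu.
- rewrite -[eval _ _]/(1 - (1 - (eval m closed_expr - eval m x_expr
    - eval m (table 1 w_expr)))).
  by rewrite Ecl Ex (Epw _ _ Ew wn); lia.
- by rewrite (Eadj _ _ _ _ Ew Eu).
- rewrite (eval_index Im) -[eval _ (Bin _ _ _)]/(eval m x_expr + eval m (table 1 u_expr)).
  by rewrite Ex Ev Eu (Epw _ _ Eu un).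
by [].
Qed.

Lemma arc_loop_correct :
  runs_within (holds 0 S (powers n) (supports (3 ^ n)) (tab 0)) (While arc_test arc_body)
    (holds N S (powers n) (supports (3 ^ n)) (tab N))
    (N.+1 * (l * test_bound arc_test + l * time_bound arc_body)).
Proof.
pose I c := holds c S (powers n) (supports (3 ^ n)) (tab c).
apply: (@runs_within_while l I); first exact: l_gt0.
  move=> i m iN Im; split; first exact: states_bounded iN Im.
  rewrite -[eval _ _]/(eval m (table 1 nvar) * eval m nvar * eval m nvar * eval m nvar
    - eval m counter).
  by rewrite !(eval_table Im) // (eval_nvar Im) /= /powers leqnn subn_eq0 -ltnNge.
move=> i iN; apply: runs_within_straight l_gt0 _ _ => // m Im.
split; first exact: states_bounded (ltnW iN) Im.
by rewrite run_seq; apply: run_next_counter; apply: relax_arc_correct.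
Qed.

Lemma write_answer_correct :
  runs_within (holds N S (powers n) (supports (3 ^ n)) (tab N)) write_answer
    (fun m => m 0 = #|E|.+1 - tab N (state_index n (3 ^ n).-1 0 0))
    (l * time_bound write_answer).
Proof.
apply: runs_within_straight l_gt0 _ _ => // m hm; split.
  exact: states_bounded (leqnn N) hm.
rewrite -[run _ _ _]/(eval m degree_sum %/ 2 + 1 -
  eval m (table 3 (index_expr (Bin Defs.Sub (table 1 nvar) (Defs.Num 1))
                (Defs.Num 0) (Defs.Num 0)))).
rewrite !(eval_table hm) // (eval_index hm).
rewrite -[eval _ (Bin _ _ _)]/(eval m (table 1 nvar) - 1) (eval_table hm) //.
by rewrite (eval_nvar hm) /= /powers leqnn mulnK // addn1 subn1.
Qed.

Lemma holds_input : holds 0 0 zero zero zero (graph_input E).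
Proof.
move=> b; rewrite /layout; case: leqP => // lt; rewrite /graph_input nth_default.
  by case: (_ %% 4) => [|[|[|k]]] //=; case: (_ %/ 4) => [|[]].
by rewrite /= size_allpairs size_enum_ord.
Qed.

Lemma runs_within_le pre P post T1 T2 : T1 <= T2 ->
  runs_within pre P post T1 -> runs_within pre P post T2.
Proof.
move=> le h m /h[m' [t [x pm le1]]]; exists m', t; split=> //; exact: leq_trans le.
Qed.

(** Gives all phases the common factor [2 * N * l], so that their times add up to [total_bound]; the
    2 comes from [i.+1 <= N + N]. *)
Lemma loop_time_le i x y : i <= N -> i.+1 * (l * x + l * y) <= 2 * N * l * (x + y).
Proof.
move=> iN; rewrite -mulnDr mulnA leq_mul2r leq_mul2r; apply/orP; right.
apply/orP; right; rewrite mul2n -addnn -addn1 leq_add //.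
by apply: leq_trans nn_le; rewrite muln_gt0 n_gt0.
Qed.

Lemma straight_time_le x : l * x <= 2 * N * l * x.
Proof.
rewrite -mulnA leq_pmull // muln_gt0 /=.
by apply: leq_trans nn_le; rewrite muln_gt0 n_gt0.
Qed.

Lemma n_le : n <= N. Proof. by apply: leq_trans nn_le; rewrite leq_pmulr. Qed.

Definition total_bound :=
  (test_bound degree_test + time_bound degree_body) +
  (time_bound power_init +
  ((test_bound power_test + time_bound power_body) +
  (time_bound support_init +
  ((test_bound support_test + time_bound support_body) +
  (time_bound state_init +
  ((test_bound arc_test + time_bound arc_body) +
  time_bound write_answer)))))).

Lemma cactus_prog_correct :
  runs_within (holds 0 0 zero zero zero) cactus_prog
    (fun m => m 0 = #|E|.+1 - tab N (state_index n (3 ^ n).-1 0 0))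
    (2 * N * l * total_bound).
Proof.
have loop i x y := @loop_time_le i x y; have str := straight_time_le.
rewrite /total_bound.
rewrite mulnDr; apply: runs_within_seq.
  exact: runs_within_le (loop _ _ _ nn_le) degree_loop_correct.
rewrite mulnDr; apply: runs_within_seq.
  exact: runs_within_le (str _) power_init_correct.
rewrite mulnDr; apply: runs_within_seq.
  exact: runs_within_le (loop _ _ _ n_le) power_loop_correct.
rewrite mulnDr; apply: runs_within_seq.
  exact: runs_within_le (str _) support_init_correct.
rewrite mulnDr; apply: runs_within_seq.
  exact: runs_within_le (loop _ _ _ pow3_le) support_loop_correct.
rewrite mulnDr; apply: runs_within_seq.
  exact: runs_within_le (str _) state_init_correct.
rewrite mulnDr; apply: runs_within_seq.
  exact: runs_within_le (loop _ _ _ (leqnn N)) arc_loop_correct.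
exact: runs_within_le (str _) write_answer_correct.
Qed.

End Correctness.

Theorem theorem3 :
  exists (P : prog) (T : nat -> nat),
    solves_edge_deletion_to_cactus_in P T /\ bigO_star T (fun n => 3 ^ n).
Proof.
(* This is [2 * N * l * total_bound] with [N = 3 ^ n * n ^ 3] and [l = 6 * n]; [total_bound] does
   not depend on the graph. *)
exists cactus_prog, (fun n => 12 * total_bound * n ^ 4 * 3 ^ n); split; last first.
  by exists (12 * total_bound), 4.
move=> n E simpleE [+ conE]; rewrite card_ord => n_gt0.
have [m [t [x m0 le]]] := cactus_prog_correct n_gt0 simpleE (@holds_input n E).
exists m, t; split=> //.
  by rewrite m0; apply: (@relaxed_min_deletion n E simpleE (Ordinal n_gt0)).
apply: leq_trans le _; rewrite !expnS expn0; move: total_bound (3 ^ n) => K p; nia.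
Qed.
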